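(* Let $\mathcal A$ be a Laurent phenomenon algebra of rank $n$ over the coefficient ring $S$, and let $t=(\mathbf x,\mathbf F)$ with $\mathbf x=\{x_1,\dots,x_n\}$ be a seed of $\mathcal A$. Then every cluster variable of $\mathcal A$ (i.e. every cluster variable in any seed of $\mathcal A$) belongs to the Laurent polynomial ring $\mathcal L(t)=S[x_1^{\pm1},\dots,x_n^{\pm1}]$.
   Context: Seeds. $S$ is a coefficient ring over $\mathbb Z$ which is a unique factorization domain; $n\ge 1$, $[n]=\{1,\dots,n\}$; the ambient field $\mathcal F$ is the field of rational functions in $n$ independent variables over $\mathrm{Frac}(S)$. A seed of rank $n$ in $\mathcal F$ is a pair $(\mathbf x,\mathbf F)$ where $\mathbf x=\{x_1,\dots,x_n\}$ (the cluster; its elements are cluster variables) is a transcendence basis of $\mathcal F$ over $\mathrm{Frac}(S)$, and $\mathbf F=\{F_1,\dots,F_n\}$ (the exchange polynomials) are polynomials in $\mathcal P=S[x_1,\dots,x_n]$ such that (LP1) each $F_i$ is an irreducible element of $\mathcal P$ and is not divisible by any variable $x_j$; (LP2) $F_i$ does not involve $x_i$. The sets are unordered, but it is recorded which exchange polynomial belongs to which cluster variable. Write $f\propto g$ if $f,g\in\mathcal F$ differ multiplicatively by a unit of $S$. Exchange Laurent polynomials. For a seed $(\mathbf x,\mathbf F)$, the elements $\hat F_1,\dots,\hat F_n\in S[x_1^{\pm1},\dots,x_n^{\pm1}]$ are the unique ones such that $\hat F_i=\big(\prod_{k\ne i}x_k^{a_k}\big)F_i$ for some integers $a_k\le 0$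 (depending on $i$), and for all $j\neq i$ the element $\hat F_i|_{x_j\leftarrow F_j/x}$ lies in $S[x_1^{\pm1},\dots,x_{j-1}^{\pm1},x^{\pm1},x_{j+1}^{\pm1},\dots,x_n^{\pm1}]$ and is not divisible by $F_j$ in this ring. Mutation. For $i\in[n]$, a tuple $(\mathbf x',\mathbf F')$ is obtained from the seed $(\mathbf x,\mathbf F)$ by mutation at $i$, written $(\mathbf x',\mathbf F')=\mu_i(\mathbf x,\mathbf F)$, if it results from the following non-deterministic procedure. Put $x_i'=\hat F_i/x_i$ and $x_j'=x_j$ for $j\ne i$; put $F_i'=F_i$. For $j\neq i$: if $F_j$ does not depend on $x_i$, then $F_j'$ is any polynomial in $\mathcal P'=S[x_1',\dots,x_n']$ with $F'_j\propto F_j$. If $F_j$ depends on $x_i$ (in which case $x_j$ does not occur in the denominator of $\hat F_i$, so $\hat F_i|_{x_j\leftarrow 0}$ is defined), put $G_j=F_j|_{x_i\leftarrow (\hat F_i|_{x_j\leftarrow0})/x_i'}$; let $H_j$ be $G_j$ with all common factors in $S[x_k:k\ne i,j]$ with $\hat F_i|_{x_j\leftarrow 0}$ removed (every irreducible factor of $\hat F_i|_{x_j\leftarrow0}$ is divided out of $G_j$ to the full power to which it divides $G_j$, monomials being immaterial); this defines $H_j$ up to a unit; finally $F_j'=MH_j$ where $M$ is a Laurent monomial in the $x_k'$, $k\neq j$, with coefficient a unit in $S$, such that $F_j'\in\mathcal P'$, $F'_j$ does not involve $x'_j$, and $F_j'$ is not divisible by any variable of $\mathcal P'$. The result of a mutation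 is always a seed. Laurent phenomenon (LP) algebras. An LP algebra of rank $n$ is a subring $\mathcal A\subset\mathcal F$ together with a distinguished collection of seeds in $\mathcal F$ such that: for each seed $(\mathbf x,\mathbf F)$ of the collection and each $i\in[n]$ we are given a seed $\mu_i(\mathbf x,\mathbf F)$ of the collection obtained from it by mutation at $i$ (so seeds form the vertices of an $n$-regular graph whose edges are mutations); all seeds are connected by mutations; and $\mathcal A$ is generated over $S$ by all cluster variables of all the seeds. *)

(* Defs.v *)
From HB Require Import structures.
From Stdlib Require Import Relation_Operators.
From mathcomp Require Import all_boot all_order all_fingroup all_algebra.
From mathcomp Require Import mpoly.
Set Implicit Arguments.
Unset Strict Implicit.
Unset Printing Implicit Defensive.
Import GRing.Theory.
Local Open Scope ring_scope.

Section Factorization.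
Variable R : idomainType.
Implicit Types (a b : R) (s t : seq R).

Definition divides a b : Prop := exists c, b = a * c.

Definition associates a b : Prop := exists2 u, u \is a GRing.unit & b = u * a.

Definition irreducible_elt a : Prop :=
  [/\ a != 0, a \isn't a GRing.unit &
      forall b c, a = b * c -> b \is a GRing.unit \/ c \is a GRing.unit].

Definition UFD : Prop :=
  (forall a, a != 0 -> a \isn't a GRing.unit ->
     exists2 s, (forall p, p \in s -> irreducible_elt p) & a = \prod_(p <- s) p)
  /\ (forall s t,
        (forall p, p \in s -> irreducible_elt p) ->
        (forall p, p \in t -> irreducible_elt p) ->
        \prod_(p <- s) p = \prod_(p <- t) p ->
        exists t', [/\ perm_eq t t', size s = size t' &
          forall k, (k < size s)%N -> associates s`_k t'`_k]).

End Factorization.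

Definition involves (S : idomainType) (n : nat) (p : {mpoly S[n]}) (i : 'I_n) :
  bool := has (fun m : 'X_{1..n} => m i != 0%N) (msupp p).

Section LP.
Variables (S : idomainType) (n : nat).

Definition ambient : fieldType := {fraction {mpoly {fraction S}[n]}}.

Definition frac_inj (c : {fraction S}) : ambient := tofrac (mpolyC n c).
Definition coef_inj (c : S) : ambient := frac_inj (tofrac c).

Definition value (x : 'I_n -> ambient) (p : {mpoly S[n]}) : ambient :=
  mmap coef_inj x p.

Definition propto (f g : ambient) : Prop :=
  exists2 u : S, u \is a GRing.unit & f = coef_inj u * g.

(* The subfield of ambient generated over Frac(S) by the x_k. *)
Definition in_ratfield (x : 'I_n -> ambient) (f : ambient) : Prop :=
  exists p q : {mpoly {fraction S}[n]},
    mmap frac_inj x q != 0 /\ f = mmap frac_inj x p / mmap frac_inj x q.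

Definition transcendence_basis (x : 'I_n -> ambient) : Prop :=
  (forall p : {mpoly {fraction S}[n]}, mmap frac_inj x p = 0 -> p = 0)
  /\ (forall f : ambient, exists q : {poly ambient},
        [/\ q != 0, forall k, in_ratfield x q`_k & root q f]).

Definition laurent (x : 'I_n -> ambient) (f : ambient) : Prop :=
  exists (p : {mpoly S[n]}) (m : 'I_n -> nat),
    f = value x p / \prod_k x k ^+ m k.

Definition laurent_divides (x : 'I_n -> ambient) (f g : ambient) : Prop :=
  exists2 h, laurent x h & g = f * h.

(* A seed is recorded with a numbering of its cluster.  Since the cluster x is
   algebraically independent, S[x_1, ..., x_n] is identified with the formal
   polynomial ring: the exchange polynomial F_i is the formal polynomial
   [exch i], whose value in the ambient field is [exch_val i]. *)
Record seed_data := SeedData {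
  cluster : 'I_n -> ambient;
  exch : 'I_n -> {mpoly S[n]} }.

Definition exch_val (t : seed_data) (i : 'I_n) : ambient :=
  value (cluster t) (exch t i).

Definition is_seed (t : seed_data) : Prop :=
  [/\ transcendence_basis (cluster t),
      forall i, irreducible_elt (exch t i),
      forall i j, ~ divides 'X_j (exch t i) &
      forall i, ~~ involves (exch t i) i].

Definition same_seed (t t' : seed_data) : Prop :=
  exists s : 'S_n, forall k, cluster t' k = cluster t (s k)
                          /\ exch_val t' k = exch_val t (s k).

(* \hat F_i = (\prod_(k != i) x_k ^ a_k) F_i is given by its exponents a_k;
   [hatF t i a y] is the result of substituting y_1, ..., y_n for the variables
   x_1, ..., x_n in it.  When y_j = 0 is used below, F_j involves x_i, which forces a_j = 0, and
   then 0 ^ a_j = 1. *)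
Definition hatF (t : seed_data) (i : 'I_n) (a : 'I_n -> int)
    (y : 'I_n -> ambient) : ambient :=
  (\prod_(k | k != i) y k ^ a k) * value y (exch t i).

(* In \hat F_i |_{x_j <- F_j / x} the new variable x takes the place of x_j in
   the Laurent polynomial ring, and neither F_j nor anything else left after the
   substitution involves x_j; so x_j itself can be reused for x. *)
Definition hat_exponents (t : seed_data) (i : 'I_n) (a : 'I_n -> int) : Prop :=
  let x := cluster t in
  (forall k, k != i -> a k <= 0)
  /\ (forall j, j != i ->
        let f := hatF t i a [eta x with j |-> exch_val t j / x j] in
        laurent x f /\ ~ laurent_divides x (exch_val t j) f).

(* The irreducible elements of S[x_k : k <> i, j] (possibly constants) that
   divide h, up to Laurent monomials; those associate to a variable, which are
   units of the Laurent polynomial ring, are left out. *)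
Definition irreducible_factor (x : 'I_n -> ambient) (i j : 'I_n) (h : ambient)
    (q : {mpoly S[n]}) : Prop :=
  [/\ irreducible_elt q, ~~ involves q i && ~~ involves q j,
      forall k, ~ divides 'X_k q & laurent_divides x (value x q) h].

(* H is G with its common factors with h removed; x' is the new cluster, which
   agrees with x outside i. *)
Definition remove_common_factors (x x' : 'I_n -> ambient) (i j : 'I_n)
    (h G H : ambient) : Prop :=
  [/\ laurent x' H,
      exists2 s : seq {mpoly S[n]},
        forall q, q \in s -> irreducible_factor x i j h q &
        G = (\prod_(q <- s) value x q) * H &
      forall q, irreducible_factor x i j h q ->
        ~ laurent_divides x' (value x q) H].

Definition mutated_exch (t : seed_data) (i : 'I_n) (a : 'I_n -> int)
    (t' : seed_data) (j : 'I_n) : Prop :=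
  let x := cluster t in
  let x' := cluster t' in
  let h := hatF t i a [eta x with j |-> 0] in
  let G := value [eta x' with i |-> h / x' i] (exch t j) in
  exists H, remove_common_factors x x' i j h G H /\
  exists (u : S) (m : 'I_n -> int),
    [/\ u \is a GRing.unit, m j = 0,
        exch_val t' j = coef_inj u * (\prod_k x' k ^ m k) * H,
        ~~ involves (exch t' j) j &
        forall k, ~ divides 'X_k (exch t' j)].

Definition mutation (t : seed_data) (i : 'I_n) (t' : seed_data) : Prop :=
  exists2 a : 'I_n -> int, hat_exponents t i a &
  [/\ cluster t' i = hatF t i a (cluster t) / cluster t i,
      forall j, j != i -> cluster t' j = cluster t j,
      exch_val t' i = exch_val t i &
      forall j, j != i ->
        if involves (exch t j) i then mutated_exch t i a t' j
        else propto (exch_val t' j) (exch_val t j)].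

(* Seeds being unordered, each seed of the collection is represented by a
   numbering of it, and the numbering of [lp_mut t i] need not be the one
   inherited from t. *)
Record LPalgebra := {
  lp_ring : ambient -> Prop;
  lp_seed : seed_data -> Prop;
  lp_mut : seed_data -> 'I_n -> seed_data;
  lp_seedP : forall t, lp_seed t -> is_seed t;
  lp_mut_seed : forall t i, lp_seed t -> lp_seed (lp_mut t i);
  lp_mutP : forall t i, lp_seed t ->
    exists2 t', mutation t i t' & same_seed t' (lp_mut t i);
  lp_connected : forall t t', lp_seed t -> lp_seed t' ->
    clos_refl_sym_trans seed_data
      (fun r r' => lp_seed r /\ exists i, r' = lp_mut r i) t t';
  lp_generated : forall f, lp_ring f <->
    exists (m : nat) (y : 'I_m -> ambient) (p : {mpoly S[m]}),
      (forall k, exists t i, lp_seed t /\ y k = cluster t i)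
      /\ f = mmap coef_inj y p }.

End LP.

(* Main.v *)
Require Import Defs.
From Stdlib Require Import Classical Relation_Operators Operators_Properties.
From Stdlib Require Import FunctionalExtensionality PropExtensionality.
From mathcomp Require Import all_boot all_order all_fingroup all_algebra.
From mathcomp Require Import mpoly ring.

Set Implicit Arguments.
Unset Strict Implicit.
Unset Printing Implicit Defensive.
Import GRing.Theory.
Local Open Scope ring_scope.

(** The proof joins two seeds by a path of mutations and goes by induction on
    its length, as in the caterpillar argument for cluster algebras.  Let
    [s0 - s1 - s2 - ...] be the path, with directions [i], [j], ..., and write
    [L] for the Laurent ring of [s0].  If [i = j], then [s2] has the same
    Laurent ring as [s0] and two steps are saved.  Otherwise mutate [s2] at
    [i], to get [s3].  The end of the path is at smaller distance from both
    [s1] and [s3], so its cluster variables are Laurent in [s1] and in [s3].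
    With [y], [z], [w] the variables created along [s0 - s1 - s2 - s3], such
    an element lies in [L[1/y]] and in [L[1/z, 1/w]], hence in [L] provided
    that [y] is prime in [L] and divides neither [z] nor [w]
    ([prime_clear_denominator], [laurent_intersection]).

    Up to a unit of [L], [y] is the exchange polynomial [F_i], and an
    irreducible polynomial over a unique factorization domain is prime: this is
    Gauss's lemma, [prime_factorial_mpoly].  That [y] does not divide [z] is
    exactly what the normalization of the exchange Laurent polynomials asks
    for ([second_step]).  For [w] ([third_step]) the interesting case is that
    [F_i] depends on [x_j].  Then [w * y] is, up to harmless factors,
    [F_i (h / z)], where [h] is the value of the exchange Laurent polynomial of
    [x_j] at [y = 0]; since [x_j * z = h + y * (...)], this is a Taylor
    expansion of [F_i] around [x_j], whose term of order [0] is again a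
    multiple of [y].  After division by [y] what remains modulo [y] is linear
    in [x_i], and its leading coefficient does not involve [x_j] except for a
    unit, so that it is not divisible by [F_i].

    Mutations are given in one direction only, while a path runs through them
    both ways.  The argument is therefore carried out with a relation [edge]
    between seeds that every mutation satisfies ([mutation_edge]) and that is
    symmetric ([edge_sym]).  Seeds enter it only through the values of their
    exchange polynomials in the ambient field, which also makes renumbering
    the variables harmless ([edge_relabel]). *)
(** * Prime elements and unique factorization *)

Section Primes.
Variable R : idomainType.
Implicit Types (a b c p u : R) (s : seq R).

Definition prime_elt p : Prop :=
  [/\ p != 0, p \isn't a GRing.unit &
      forall a b, divides p (a * b) -> divides p a \/ divides p b].

(** Equivalent to unique factorization, and unlike it easy to pass from a ring
    to its polynomial ring. *)
Definition prime_factorial : Prop :=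
  forall a, a != 0 -> exists u s,
    [/\ u \is a GRing.unit, forall p, p \in s -> prime_elt p &
        a = u * \prod_(p <- s) p].

Lemma divides_mulr a b c : divides a b -> divides a (b * c).
Proof. by move=> [d ->]; exists (d * c); rewrite mulrA. Qed.

Lemma divides_mull a b c : divides a b -> divides a (c * b).
Proof. by rewrite mulrC; apply: divides_mulr. Qed.

Lemma divides_mem p s : p \in s -> divides p (\prod_(q <- s) q).
Proof.
by move=> ps; rewrite (perm_big _ (perm_to_rem ps)) big_cons; exists (\prod_(q <- rem p s) q).
Qed.

(** An irreducible element has a single prime factor, hence is associate to it. *)
Lemma prime_factorial_irreducible :
  prime_factorial -> forall a, irreducible_elt a -> prime_elt a.
Proof.
move=> fR a [a0 aU irr].
have [u [s [uU sP aE]]] := fR _ a0.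
case: s sP aE => [|p s] sP aE; first by rewrite aE big_nil mulr1 uU in aU.
have [p0 pU pP] := sP p (mem_head _ _).
have {aE} aE : a = p * (u * \prod_(q <- s) q) by rewrite aE big_cons mulrCA.
case: (irr _ _ aE) => [|vU]; first by rewrite (negPf pU).
set v := u * _ in aE vU; split=> // b c [d E].
have pbc : divides p (b * c) by rewrite E aE -mulrA; exists (v * d).
by case: (pP _ _ pbc) => -[e ->]; [left|right]; exists (v^-1 * e);
   rewrite aE mulrA mulrK.
Qed.

Lemma irreducible_unitM u a :
  u \is a GRing.unit -> irreducible_elt a -> irreducible_elt (u * a).
Proof.
move=> uU [a0 aU irr]; split.
- by rewrite mulf_neq0 //; apply: contraTneq uU => ->; rewrite unitr0.
- by rewrite unitrM uU.
move=> b c E; have /irr : a = (u^-1 * b) * c by rewrite -mulrA -E mulKr.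
by rewrite unitrM unitrV uU.
Qed.

(** If [p * c = a * b] with [p] irreducible, then [p] occurs up to a unit among
    the factors of [a] and [b].  Uniqueness is about products without unit
    factors, whence the unit [v] absorbed by [p] below. *)
Lemma UFD_prime_factorial : UFD R -> prime_factorial.
Proof.
move=> [ex uniq].
have fact a : a != 0 -> exists u s, [/\ u \is a GRing.unit,
    forall p, p \in s -> irreducible_elt p & a = u * \prod_(p <- s) p].
  move=> a0; case: (boolP (a \is a GRing.unit)) => aU.
    by exists a, [::]; rewrite big_nil mulr1.
  by have [s sP ->] := ex a a0 aU; exists 1, s; rewrite mul1r unitr1.
suff irr_prime p : irreducible_elt p -> prime_elt p.
  move=> a /fact [u [s [uU sP ->]]].
  by exists u, s; split=> // p /sP /irr_prime.
move=> pI; have [p0 pU _] := pI; split=> // a b [c E].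
case: (eqVneq a 0) => [->|a0]; first by left; exists 0; rewrite mulr0.
case: (eqVneq b 0) => [->|b0]; first by right; exists 0; rewrite mulr0.
have c0 : c != 0 by apply: contraTneq (mulf_neq0 a0 b0); rewrite E => ->; rewrite mulr0 eqxx.
have [ua [sa [uaU saP aE]]] := fact _ a0.
have [ub [sb [ubU sbP bE]]] := fact _ b0.
have [uc [sc [ucU scP cE]]] := fact _ c0.
pose v := (ua * ub)^-1 * uc.
have vU : v \is a GRing.unit by rewrite !unitrM !unitrV unitrM uaU ubU.
have eqs : \prod_(q <- v * p :: sc) q = \prod_(q <- sa ++ sb) q.
  have uabU : ua * ub \is a GRing.unit by rewrite unitrM uaU.
  apply: (mulrI uabU); have vE : ua * ub * v = uc by rewrite mulVKr.
  rewrite big_cons big_cat /= 2!mulrA vE.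
  move: E; rewrite aE bE cE => E; transitivity (p * (uc * \prod_(q <- sc) q)); first by ring.
  by rewrite -E; ring.
have vsP q : q \in v * p :: sc -> irreducible_elt q.
  by rewrite inE => /orP[/eqP->|/scP//]; apply: irreducible_unitM.
have sabP q : q \in sa ++ sb -> irreducible_elt q.
  by rewrite mem_cat => /orP[/saP|/sbP].
have [t' [pt st /(_ 0%N isT)/= [w wU wE]]] := uniq _ _ vsP sabP eqs.
set q := t'`_0 in wE.
have : q \in sa ++ sb by rewrite (perm_mem pt); apply/mem_nth; rewrite -st.
have pq : divides p q by exists (w * v); rewrite wE; ring.
have key x d : divides q d -> divides p (x * d).
  by case: pq => e -> [f ->]; exists (x * (e * f)); ring.
by rewrite mem_cat => /orP[] /divides_mem; [rewrite aE; left|rewrite bE; right]; apply: key.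
Qed.

End Primes.

(** ** Gauss's lemma *)

Section Gauss.
Variable R : idomainType.
Hypothesis fR : prime_factorial R.
Implicit Types (a b : R) (f g h : {poly R}).

Lemma divides_polyC a f : divides a%:P f <-> forall k, divides a f`_k.
Proof.
split=> [[g ->] k|df]; first by exists g`_k; rewrite coefCM.
have : forall k, exists b, f`_k == a * b by move=> k; have [b ->] := df k; exists b.
move=> ch; exists (\poly_(k < size f) xchoose (ch k)).
apply/polyP => k; rewrite coefCM coef_poly; case: ltnP => [_|le].
  exact/eqP/(xchooseP (ch k)).
by rewrite mulr0 nth_default.
Qed.

(** If [a] divides neither [f] nor [g], it does not divide the coefficient of
    their product at the sum of the first two bad degrees. *)
Lemma prime_polyC a : prime_elt a -> prime_elt a%:P.
Proof.
move=> [a0 aU aP]; split=> [||f g dfg].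
- by rewrite polyC_eq0.
- by rewrite poly_unitE coefC /= (negPf aU) andbF.
case: (classic (divides a%:P f)) => [|nf]; first by left.
case: (classic (divides a%:P g)) => [|ng]; first by right.
have first_bad h : ~ divides a%:P h ->
    exists2 k, ~ divides a h`_k & forall l, (l < k)%N -> divides a h`_l.
  move=> nh; apply: NNPP => no; apply: nh; apply/divides_polyC => k.
  elim/ltn_ind: k => k IH; apply: NNPP => nk; apply: no.
  by exists k.
have [k fk fl] := first_bad _ nf; have [m gm gl] := first_bad _ ng.
have /divides_polyC/(_ (k + m)%N) := dfg.
have km : (k < (k + m).+1)%N by rewrite ltnS leq_addr.
rewrite coefM (bigD1 (Ordinal km)) //= addKn => -[c E].
suff : divides a (f`_k * g`_m) by case/aP.
have : divides a (\sum_(i < (k + m).+1 | i != Ordinal km) f`_i * g`_(k + m - i)).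
  elim/big_ind: _ => [|x y [u ->] [v ->]|i ik]; first by exists 0; rewrite mulr0.
    by exists (u + v); rewrite mulrDr.
  have {}ik : val i != k by apply: contraNneq ik => ik; apply/eqP/val_inj.
  case: (ltngtP i k) ik => // ik _; first exact/divides_mulr/fl.
  by apply/divides_mull/gl; rewrite ltn_subLR ?ltn_add2r // -ltnS ltn_ord.
by move=> [d Ed]; exists (c - d); rewrite mulrBr -E -Ed addrK.
Qed.

(** Divisibility up to a constant is divisibility when [f] has no prime constant
    factor: remove the prime factors of the constant one by one. *)
Lemma cancel_const f g h a : a != 0 ->
  (forall p, prime_elt p -> ~ divides p%:P f) ->
  a *: g = f * h -> divides f g.
Proof.
move=> a0 fP; have [u [s [uU sP ->]]] := fR a0.
elim: s sP h => [|p s IH] sP h.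
  rewrite big_nil mulr1 => E; exists (u^-1 *: h).
  by rewrite -scalerAr -E scalerA mulVr // scale1r.
rewrite big_cons => E; have pp := sP p (mem_head _ _).
have [k hE] : divides p%:P h.
  have [_ _ P] := prime_polyC pp; have /P[] // : divides p%:P (f * h).
    by exists ((u * \prod_(q <- s) q) *: g); rewrite -E mul_polyC scalerA mulrCA.
  by move/(fP _ pp).
apply: (IH _ k) => [q qs|]; first by apply: sP; rewrite inE qs orbT.
have p0 : p%:P != 0 by have [] := prime_polyC pp.
apply: (mulfI p0); rewrite mulrCA -hE -E mul_polyC scalerA; congr (_ *: _); ring.
Qed.

End Gauss.

Section GaussLemma.
Variable R : idomainType.
Hypothesis fR : prime_factorial R.
Implicit Types (f g h : {poly R}).

Import Pdiv.CommonIdomain.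

Definition primitive f : Prop := forall p : R, prime_elt p -> ~ divides p%:P f.

Lemma size1_primitive_unit f :
  f != 0 -> primitive f -> (size f <= 1)%N -> f \is a GRing.unit.
Proof.
move=> f0 fP /size1_polyC fE; rewrite fE in f0 fP *.
rewrite polyC_eq0 in f0; have [u [s [uU sP cE]]] := fR f0.
case: s sP cE => [|p s] sP cE.
  by rewrite rmorph_unit // cE big_nil mulr1.
case: (fP p (sP p (mem_head _ _))).
by exists (u * \prod_(q <- s) q)%:P; rewrite -polyCM cE big_cons mulrCA.
Qed.

Lemma primitive_divisor f g : divides g f -> primitive f -> primitive g.
Proof. by move=> [h ->] fP p /fP np dg; apply/np/divides_mulr. Qed.

(** A pseudo-factorization [c *: f = q * r] can be freed from its constant
    [c], each prime factor of which divides [q] or [r]. *)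
Lemma clear_constant f q r a : a != 0 -> a *: f = q * r ->
  exists q' r', [/\ f = q' * r', size q' = size q & size r' = size r].
Proof.
move=> a0; have [u [s [uU sP ->]]] := fR a0.
have u0 : u != 0 by apply: contraTneq uU => ->; rewrite unitr0.
elim: s sP q r => [|p s IH] sP q r.
  rewrite big_nil mulr1 => E; exists (u^-1 *: q), r; split=> //.
    by rewrite -scalerAl -E scalerA mulVr // scale1r.
  by rewrite size_scale // invr_eq0.
rewrite big_cons => E; have pp := sP p (mem_head _ _).
have {}IH := IH (fun q qs => sP q (@mem_behead _ (p :: s) _ qs)).
have [p0 _ P] := prime_polyC pp; have [_ _ _] := pp; rewrite polyC_eq0 in p0.
have E' : p *: ((u * \prod_(q <- s) q) *: f) = q * r by rewrite scalerA mulrCA.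
have : divides p%:P q \/ divides p%:P r.
  by apply: P; exists ((u * \prod_(q <- s) q) *: f); rewrite -E' mul_polyC.
have step k : p *: ((u * \prod_(q <- s) q) *: f) = p%:P * k ->
    (u * \prod_(q <- s) q) *: f = k.
  by rewrite -mul_polyC => /mulfI->//; rewrite polyC_eq0.
case=> -[k kE]; rewrite kE in E' *.
  have /step/IH[q' [r' [fE sq sr]]] :
    p *: ((u * \prod_(q <- s) q) *: f) = p%:P * (k * r) by rewrite E' mulrA.
  by exists q', r'; rewrite sq mul_polyC size_scale.
have /step/IH[q' [r' [fE sq sr]]] :
  p *: ((u * \prod_(q <- s) q) *: f) = p%:P * (q * k) by rewrite E' mulrCA.
by exists q', r'; rewrite sr mul_polyC size_scale.
Qed.

Lemma irreducible_primitive f :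
  irreducible_elt f -> (1 < size f)%N -> primitive f.
Proof.
move=> [_ _ irr] sf p [p0 pU _] [h fE].
case: (irr _ _ fE); first by rewrite poly_unitE coefC /= (negPf pU) andbF.
rewrite poly_unitE => /andP[/eqP sh _].
by move: sf; rewrite fE mul_polyC size_scale // sh.
Qed.

(** The non-constant case of Gauss's lemma: pseudo-division shows that [f]
    divides a multiple of one of the factors by a constant, which is then
    removed because [f] is primitive. *)
Lemma irreducible_prime_poly f :
  irreducible_elt f -> (1 < size f)%N -> prime_elt f.
Proof.
move=> fI sf; have fP := irreducible_primitive fI sf.
have [f0 fU irr] := fI; split=> // g h [k ghE].
have pseudo x : dvdp f x -> divides f x.
  case/Pdiv.WeakIdomain.dvdpP => -[a q] /= a0 E.
  by apply: (cancel_const fR a0 fP (h := q)); rewrite E mulrC.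
have fgh : dvdp f (g * h) by rewrite ghE; apply: dvdp_mulr.
case: (boolP (coprimep f g)) => [cfg|].
  by right; apply/pseudo; rewrite -(Gauss_dvdpr _ cfg).
rewrite coprimep_def => sd; left; apply: pseudo.
set d := gcdp f g in sd; have /Pdiv.WeakIdomain.dvdpP[[a q] /= a0 E] := dvdp_gcdl f g.
have [q' [d' [fE sq sd']]] := clear_constant a0 E.
have d'U : d' \isn't a GRing.unit by rewrite poly_unitE sd' (negPf sd).
case: (irr _ _ fE) => [|]; last by rewrite (negPf d'U).
rewrite poly_unitE sq => /andP[/eqP s1 _].
have qC := size1_polyC (eq_leq s1).
have q0 : q`_0 != 0 by rewrite -polyC_eq0 -qC -size_poly_gt0 s1.
have : dvdp f (q`_0 *: d).
  by rewrite -mul_polyC -qC -E dvdpZr.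
by rewrite dvdpZr // => /dvdp_trans; apply; apply: dvdp_gcdr.
Qed.

Lemma primitive_factorization f : f != 0 -> primitive f -> exists u s,
  [/\ u \is a GRing.unit, forall p, p \in s -> prime_elt p &
      f = u * \prod_(p <- s) p].
Proof.
have [m] := ubnP (size f); elim: m f => // m IH f sf f0 fP.
case: (leqP (size f) 1) => [s1|s1].
  by exists f, [::]; rewrite big_nil mulr1 size1_primitive_unit.
have fU : f \isn't a GRing.unit by rewrite poly_unitE gtn_eqF.
case: (classic (irreducible_elt f)) => [fI|nI].
  exists 1, [:: f]; rewrite unitr1 big_seq1 mul1r; split=> // p.
  by rewrite inE => /eqP->; apply: irreducible_prime_poly.
have [g [h [fE gU hU]]] : exists g h,
    [/\ f = g * h, g \isn't a GRing.unit & h \isn't a GRing.unit].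
  apply: NNPP => no; apply: nI; split=> // g h fE.
  case: (boolP (g \is a GRing.unit)) => gU; first by left.
  by right; apply: contraT => hU; case: no; exists g, h.
have : g * h != 0 by rewrite -fE.
rewrite mulf_eq0 negb_or => /andP[g0 h0].
have gP : primitive g by apply: (primitive_divisor _ fP); exists h.
have hP : primitive h by apply: (primitive_divisor _ fP); exists g; rewrite mulrC.
have sg : (1 < size g)%N by rewrite ltnNge; apply: contra gU; apply: size1_primitive_unit.
have sh : (1 < size h)%N by rewrite ltnNge; apply: contra hU; apply: size1_primitive_unit.
have sfE : size f = (size g + size h).-1 by rewrite fE size_mul.
have [|u [s [uU sP gE]]] := IH g _ g0 gP.
  apply: leq_trans (_ : size g < size f)%N _ => //; rewrite sfE.
  by case: (size h) sh => [|[|k]] //= _; rewrite !addnS /= ltnS leq_addr.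
have [|v [r [vU rP hE]]] := IH h _ h0 hP.
  apply: leq_trans (_ : size h < size f)%N _ => //; rewrite sfE.
  by case: (size g) sg => [|[|k]] //= _; rewrite !addSn /= ltnS leq_addl.
exists (u * v), (s ++ r); rewrite unitrM uU vU big_cat; split=> //=.
  2: by rewrite fE gE hE; ring.
by move=> p; rewrite mem_cat => /orP[/sP|/rP].
Qed.

(** The prime constants dividing [f] divide its leading coefficient, so only
    finitely many can be split off before [f] becomes primitive. *)
Lemma prime_factorial_poly : prime_factorial {poly R}.
Proof.
move=> f f0; have := f0; rewrite -lead_coef_eq0 => l0.
have [u [s [uU sP]]] := fR l0.
have [m] := ubnP (size s); elim: m => // m IH in f f0 {l0} u uU s sP *.
move=> ss lE; case: (classic (primitive f)); first exact: primitive_factorization.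
move=> nP; have [p pp [g fE]] : exists2 p : R, prime_elt p & divides p%:P f.
  by apply: NNPP => no; apply: nP => p pp dp; apply: no; exists p.
have : p%:P * g != 0 by rewrite -fE.
rewrite mulf_eq0 negb_or polyC_eq0 => /andP[p0 g0].
have lfE : lead_coef f = p * lead_coef g by rewrite fE lead_coefM lead_coefC.
have [_ pU pP] := pp.
have dvd_prod t : divides p (u * \prod_(q <- t) q) -> exists2 q, q \in t & divides p q.
  elim: t => [|q t IHt].
    by rewrite big_nil mulr1 => -[c uE]; move: uU; rewrite uE unitrM (negPf pU).
  rewrite big_cons mulrCA => /pP[dq|/IHt[q' q't dq']].
    by exists q; rewrite ?mem_head.
  by exists q'; rewrite // inE q't orbT.
have [|q qs [c qE]] := dvd_prod s; first by rewrite -lE lfE; exists (lead_coef g).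
have cU : c \is a GRing.unit.
  have [q0 qU qP] := sP q qs.
  have /qP[[d pE]|[d cE]] : divides q (p * c) by rewrite -qE; exists 1; rewrite mulr1.
    have : q * 1 = q * (d * c) by rewrite mulr1 {1}qE pE mulrA.
    by move/(mulfI q0)/esym => E; apply/unitrP; exists d; split; rewrite // mulrC.
  have : q * 1 = q * (d * p) by rewrite mulr1 {1}qE cE mulrCA mulrA [d * p]mulrC mulrA.
  by move/(mulfI q0)/esym => E; case/negP: pU; apply/unitrP; exists d; split; rewrite // mulrC.
have ucU : u * c \is a GRing.unit by rewrite unitrM uU.
have remP x : x \in rem q s -> prime_elt x by move=> /mem_rem /sP.
have [||v [t [vU tP gE]]] := IH g g0 (u * c) ucU (rem q s) remP.
- by rewrite size_rem // -ltnS; case: (s) qs ss.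
- apply: (mulfI p0); rewrite -lfE lE (perm_big _ (perm_to_rem qs)) big_cons /= {1}qE.
  ring.
exists v, (p%:P :: t); split=> [//|x|]; last by rewrite big_cons fE gE; ring.
by rewrite inE => /orP[/eqP->|/tP//]; apply: prime_polyC.
Qed.

End GaussLemma.

(** * Multivariate polynomials *)

Section Mmap.
Variables (n : nat) (R : idomainType).
Implicit Types (p : {mpoly R[n]}).

Lemma rmorph_mmap (T U : comNzRingType) (phi : {rmorphism T -> U})
    (f : R -> T) (h : 'I_n -> T) p :
  phi (mmap f h p) = mmap (phi \o f) (phi \o h) p.
Proof.
rewrite /mmap rmorph_sum; apply: eq_bigr => m _.
rewrite rmorphM rmorph_prod; congr (_ * _).
by apply: eq_bigr => k _; rewrite rmorphXn.
Qed.

Lemma eq_mmap (T : comNzRingType) (f g : R -> T) (h h' : 'I_n -> T) p :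
  f =1 g -> (forall k, involves p k -> h k = h' k) -> mmap f h p = mmap g h' p.
Proof.
move=> fg hh'; rewrite /mmap; apply: eq_big_seq => m mp; rewrite fg; congr (_ * _).
apply: eq_bigr => k _; case: (eqVneq (m k) 0%N) => [->|mk]; first by rewrite !expr0.
by rewrite hh' //; apply/hasP; exists m.
Qed.

Lemma mmap_id p : mmap (@mpolyC n R) (fun i => 'X_i) p = p.
Proof.
rewrite [RHS]mpolyE; apply: eq_bigr => m _.
by rewrite mmap1_id mul_mpolyC.
Qed.

End Mmap.

Lemma prime_factorial_iso (A B : idomainType) (f : {rmorphism A -> B}) (g : B -> A) :
  cancel f g -> cancel g f -> prime_factorial B -> prime_factorial A.
Proof.
move=> fK gK fB a a0; have fI := can_inj fK.
have g0 b : b != 0 -> g b != 0.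
  by apply: contra_neq => gb; rewrite -(gK b) gb rmorph0.
have gU b : (g b \is a GRing.unit) = (b \is a GRing.unit).
  apply/unitrP/unitrP => -[c [l r]].
    by exists (f c); rewrite -{1 2}(gK b) -!rmorphM l r rmorph1.
  by exists (g c); split; apply: fI; rewrite rmorphM !gK ?l ?r rmorph1.
have [|u [s [uU sP E]]] := fB (f a).
  by apply: contra_neq a0 => fa; apply: fI; rewrite fa rmorph0.
exists (g u), (map g s); rewrite gU; split=> //.
  move=> _ /mapP[p /sP[p0 pU pP] ->]; split; rewrite ?g0 ?gU // => b c [d bcE].
  have dvd x : divides p (f x) -> divides (g p) x.
    by move=> [e xE]; exists (g e); apply: fI; rewrite rmorphM !gK.
  have /pP[] : divides p (f b * f c) by exists (f d); rewrite -rmorphM bcE rmorphM gK.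
    by left; apply: dvd.
  by right; apply: dvd.
apply: fI; rewrite E rmorphM rmorph_prod big_map gK; congr (_ * _).
by apply: eq_bigr => p _; rewrite gK.
Qed.

Section LastVariable.
Variables (n : nat) (R : idomainType).

Definition add_var : {rmorphism {mpoly R[n]} -> {mpoly R[n.+1]}} :=
  mmap (@mpolyC _ _) (fun j => 'X_(lift ord_max j)).

Definition last_var : {rmorphism {mpoly R[n.+1]} -> {poly {mpoly R[n]}}} :=
  mmap (polyC \o @mpolyC _ _)
    (fun i => if unlift ord_max i is Some j then ('X_j)%:P else 'X).

Definition last_var_inv (q : {poly {mpoly R[n]}}) : {mpoly R[n.+1]} :=
  (map_poly add_var q).['X_ord_max].

Lemma add_varX j : add_var 'X_j = 'X_(lift ord_max j).
Proof. by rewrite -[add_var _]/(mmap _ _ _) mmapX mmap1U. Qed.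

Lemma add_varC c : add_var c%:MP = c%:MP.
Proof. by rewrite -[add_var _]/(mmap _ _ _) mmapC. Qed.

Lemma last_varX j : last_var 'X_j = if unlift ord_max j is Some k then ('X_k)%:P else 'X.
Proof. by rewrite -[last_var _]/(mmap _ _ _) mmapX mmap1U. Qed.

Lemma last_varC c : last_var c%:MP = c%:MP%:P.
Proof. by rewrite -[last_var _]/(mmap _ _ _) mmapC. Qed.

Lemma last_varK : cancel last_var last_var_inv.
Proof.
move=> p; rewrite /last_var_inv -[_.[_]]/((horner_eval 'X_ord_max \o map_poly add_var) _).
rewrite rmorph_mmap -[RHS]mmap_id; apply: eq_mmap => [c|k _] /=.
  by rewrite /horner_eval map_polyC hornerC /= add_varC.
case: unliftP => [j|] ->; rewrite /horner_eval.
  by rewrite map_polyC hornerC /= add_varX.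
by rewrite map_polyX hornerX.
Qed.

Lemma last_var_invK : cancel last_var_inv last_var.
Proof.
move=> q; rewrite /last_var_inv -horner_map -map_poly_comp.
have -> : last_var 'X_ord_max = 'X.
  by rewrite last_varX unlift_none.
rewrite -[RHS]comp_polyXr /comp_poly; congr (_.[_]).
apply: eq_map_poly => r /=; rewrite -[in RHS](mmap_id r) -[add_var _]/(mmap _ _ _) !rmorph_mmap.
apply: eq_mmap => [c|k _] /=.
  exact: last_varC.
by rewrite last_varX liftK.
Qed.

End LastVariable.

Lemma prime_factorial_mpoly (n : nat) (R : idomainType) :
  prime_factorial R -> prime_factorial {mpoly R[n]}.
Proof.
move=> fR; elim: n => [|n IH].
  apply: (@prime_factorial_iso _ _ (mcoeff 0%MM) (@mpolyC 0 R)) => // [p|c].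
    by apply/mpolyP => m; rewrite /= mcoeffC (_ : m = 0%MM) ?eqxx ?mulr1 //; apply/mnmP => -[].
  by rewrite /= mcoeffC eqxx mulr1.
apply: (@prime_factorial_iso _ _ (@last_var n R) (@last_var_inv n R)).
- exact: last_varK.
- exact: last_var_invK.
exact: prime_factorial_poly.
Qed.

(** ** One variable singled out *)

Section Expand.
Variables (n : nat) (R : idomainType).
Implicit Types (p q : {mpoly R[n]}) (j : 'I_n).

(** The value of [p] at [x], as a polynomial in the [j]-th entry of [x]. *)
Definition expand (T : comNzRingType) (f : {rmorphism R -> T}) (x : 'I_n -> T) j :
    {rmorphism {mpoly R[n]} -> {poly T}} :=
  mmap (polyC \o f) (fun k => if k == j then 'X else (x k)%:P).

Lemma horner_expand (T : comNzRingType) (f : {rmorphism R -> T}) x j p y :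
  (expand f x j p).[y] = mmap f [eta x with j |-> y] p.
Proof.
rewrite -[LHS]/(horner_eval y _) rmorph_mmap.
apply: eq_mmap => [c|k _] /=; rewrite /horner_eval ?hornerC //.
by case: eqP; rewrite ?hornerX ?hornerC.
Qed.

Lemma horner_expand_id (T : comNzRingType) (f : {rmorphism R -> T}) x j p :
  (expand f x j p).[x j] = mmap f x p.
Proof. by rewrite horner_expand; apply: eq_mmap => // k _ /=; case: eqP => [->|]. Qed.

(** [p] itself as a polynomial in its [j]-th variable; the coefficients are kept
    in the same polynomial ring, where they do not involve that variable. *)
Definition formal j := expand (@mpolyC n R) (fun i => 'X_i) j.

Lemma formalX j : formal j 'X_j = 'X.
Proof. by rewrite -[LHS]/(mmap _ _ _) mmapX mmap1U eqxx. Qed.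

Lemma horner_formal j p : (formal j p).['X_j] = p.
Proof. by rewrite horner_expand_id mmap_id. Qed.

Lemma size_formal j p : involves p j -> (1 < size (formal j p))%N.
Proof.
move=> /hasP[m mp mj]; rewrite ltnNge; apply/negP => /size1_polyC fE.
have := horner_formal j p; rewrite fE hornerC -horner_coef0 horner_expand => pE.
have : p@_m = 0.
  rewrite -pE raddf_sum big1_seq //= => m' m'p; rewrite mul_mpolyC mcoeffZ.
  case: (eqVneq (m' j) 0%N) => m'j.
    rewrite /mmap1 (eq_bigr (fun k => 'X_k ^+ (m' k))) => [|k _].
      rewrite -[\prod_k _]/(mmap1 _ _) mmap1_id mcoeffX (_ : (m' == m) = false) ?mulr0 //.
      by apply/eqP => mm; rewrite -mm m'j eqxx in mj.
    by rewrite /=; case: eqP => // ->; rewrite m'j !expr0.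
  by rewrite /mmap1 (bigD1 j) //= eqxx expr0n (negPf m'j) mul0r mcoeff0 mulr0.
by move/eqP; rewrite mcoeff_eq0 mp.
Qed.

Lemma divides_X j p : (formal j p)`_0 = 0 -> divides 'X_j p.
Proof.
rewrite -horner_coef0 => /rootP/factor_theorem[q qE].
by exists q.['X_j]; rewrite -{1}(horner_formal j p) qE hornerM subr0 hornerX mulrC.
Qed.

(** Comparing constant terms in ['X_j = p * q], one of [p] and [q] is divisible
    by ['X_j]; it must be [q], and then [p] is a unit. *)
Lemma nondivisor_of_X p : p \isn't a GRing.unit ->
  (forall j, ~ divides 'X_j p) -> forall j, ~ divides p 'X_j.
Proof.
move=> pU pX j [q E].
have X0 : 'X_j != 0 :> {mpoly R[n]} by rewrite -msupp_eq0 msuppX.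
have : (formal j p)`_0 * (formal j q)`_0 = 0.
  by rewrite -coef0M -rmorphM -E formalX coefX.
move/eqP; rewrite mulf_eq0 => /orP[] /eqP /divides_X; first exact: pX.
move=> [c qE]; have /(mulfI X0)/esym E1 : 'X_j * 1 = 'X_j * (p * c).
  by rewrite mulr1 {1}E qE mulrCA.
by case/negP: pU; apply/unitrP; exists c; rewrite mulrC E1.
Qed.

End Expand.
Arguments formal {n R} j.

(** * Subrings of a field *)

Section Subring.
Variable K : fieldType.
Implicit Types (P : K -> Prop) (f g : {poly K}) (a b c p q u v z : K).

Definition is_subring P : Prop :=
  [/\ P 1, forall a b, P a -> P b -> P (a - b) & forall a b, P a -> P b -> P (a * b)].

Definition coefs_in P f : Prop := forall k, P f`_k.

Definition unit_in P u : Prop := [/\ P u, P u^-1 & u != 0].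

Definition divides_in P a b : Prop := exists2 c, P c & b = a * c.

Definition prime_in P p : Prop :=
  [/\ P p, p != 0, ~ divides_in P p 1 &
      forall a b, P a -> P b -> divides_in P p (a * b) ->
        divides_in P p a \/ divides_in P p b].

Section Closure.
Variable P : K -> Prop.
Hypothesis subP : is_subring P.

Lemma in1 : P 1. Proof. by case: subP. Qed.
Lemma inB a b : P a -> P b -> P (a - b). Proof. by case: subP => _ + _; apply. Qed.
Lemma inM a b : P a -> P b -> P (a * b). Proof. by case: subP => _ _; apply. Qed.
Lemma in0 : P 0. Proof. by rewrite -(subrr 1); apply: inB; exact: in1. Qed.
Lemma inN a : P a -> P (- a).
Proof. by rewrite -sub0r; apply: inB; exact: in0. Qed.
Lemma inD a b : P a -> P b -> P (a + b).
Proof. by move=> Pa Pb; rewrite -[b]opprK; apply/inB/inN. Qed.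
Lemma inX a m : P a -> P (a ^+ m).
Proof. by move=> Pa; elim: m => [|m IH]; rewrite ?exprS; [exact: in1|exact: inM]. Qed.
Lemma in_sum I (r : seq I) (C : pred I) (F : I -> K) :
  (forall i, C i -> P (F i)) -> P (\sum_(i <- r | C i) F i).
Proof. by move=> H; elim/big_ind: _ => //; [exact: in0|exact: inD]. Qed.
Lemma in_prod I (r : seq I) (C : pred I) (F : I -> K) :
  (forall i, C i -> P (F i)) -> P (\prod_(i <- r | C i) F i).
Proof. by move=> H; elim/big_ind: _ => //; [exact: in1|exact: inM]. Qed.

Lemma coefs_inC a : P a -> coefs_in P a%:P.
Proof. by move=> Pa [|k]; rewrite coefC //=; exact: in0. Qed.
Lemma coefs_inXn m : coefs_in P 'X^m.
Proof. by move=> k; rewrite coefXn; case: eqP => _; [exact: in1|exact: in0]. Qed.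
Lemma coefs_inB f g : coefs_in P f -> coefs_in P g -> coefs_in P (f - g).
Proof. by move=> Pf Pg k; rewrite coefB; apply: inB. Qed.
Lemma coefs_inD f g : coefs_in P f -> coefs_in P g -> coefs_in P (f + g).
Proof. by move=> Pf Pg k; rewrite coefD; apply: inD. Qed.
Lemma coefs_inM f g : coefs_in P f -> coefs_in P g -> coefs_in P (f * g).
Proof. by move=> Pf Pg k; rewrite coefM; apply: in_sum => i _; apply: inM. Qed.
Lemma coefs_inZ a f : P a -> coefs_in P f -> coefs_in P (a *: f).
Proof. by move=> Pa Pf k; rewrite coefZ; apply: inM. Qed.
Lemma coefs_in_sum I (r : seq I) (C : pred I) (F : I -> {poly K}) :
  (forall i, C i -> coefs_in P (F i)) -> coefs_in P (\sum_(i <- r | C i) F i).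
Proof. by move=> H k; rewrite coef_sum; apply: in_sum => i /H. Qed.
Lemma coefs_in_prod I (r : seq I) (C : pred I) (F : I -> {poly K}) :
  (forall i, C i -> coefs_in P (F i)) -> coefs_in P (\prod_(i <- r | C i) F i).
Proof.
move=> H; elim/big_ind: _ => //; first exact: (@coefs_inXn 0).
exact: coefs_inM.
Qed.
Lemma coefs_in_exp f m : coefs_in P f -> coefs_in P (f ^+ m).
Proof.
move=> Pf; elim: m => [|m IH]; rewrite ?exprS; last exact: coefs_inM.
exact: (@coefs_inXn 0).
Qed.
Lemma coefs_in_deriv f : coefs_in P f -> coefs_in P f^`().
Proof.
move=> Pf k; rewrite coef_deriv; elim: {2}k.+1 => [|m IH].
  exact: in0.
by rewrite mulrS; apply: inD.
Qed.
Lemma in_horner f a : coefs_in P f -> P a -> P f.[a].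
Proof.
by move=> Pf Pa; rewrite horner_coef; apply: in_sum => i _; apply/inM/inX.
Qed.

(** The expansion at [0] to order two: the second coefficient is the one that
    survives a division by [a] modulo [a]. *)
Lemma horner_split f a : coefs_in P f -> P a ->
  exists2 b, P b & f.[a] = f`_0 + a * f`_1 + a ^+ 2 * b.
Proof.
move=> Pf Pa; exists (drop_poly 2 f).[a].
  by apply: in_horner => // k; rewrite coef_drop_poly.
rewrite -{1}(poly_take_drop 2 f) hornerD hornerM hornerXn [_ * a ^+ 2]mulrC; congr (_ + _).
rewrite (horner_coef_wide _ (size_take_poly 2 f)) !big_ord_recr big_ord0 /= add0r.
by rewrite !coef_take_poly /= expr0 mulr1 expr1 mulrC.
Qed.

Lemma taylor f a b : coefs_in P f -> P a -> P b ->
  exists2 c, P c & f.[a + b] = f.[a] + b * f^`().[a] + b ^+ 2 * c.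
Proof.
move=> + Pa Pb; elim/poly_ind: f => [|f c IH] Pf.
  by exists 0; rewrite ?deriv0 ?horner0; [exact: in0|ring].
have {}Pf : coefs_in P f by move=> k; have := Pf k.+1; rewrite coefD coefMX coefC /= addr0.
have [d Pd E] := IH Pf; exists (d * (a + b) + f^`().[a]).
  by apply: inD; [apply/inM/inD|apply/in_horner => //; exact: coefs_in_deriv].
by rewrite derivD derivM derivX derivC !hornerE E; ring.
Qed.

(** The polynomial [z ^ (size f) * f (u / z)] in [z]. *)
Definition reversal u f : {poly K} :=
  \sum_(k < size f) (f`_k * u ^+ k) *: 'X^(size f - k).

Lemma coef_reversal u f k : (k < size f)%N ->
  (reversal u f)`_(size f - k) = f`_k * u ^+ k.
Proof.
move=> kf; rewrite coef_sum (bigD1 (Ordinal kf)) //= coefZ coefXn eqxx mulr1.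
rewrite big1 ?addr0 // => l lk; rewrite coefZ coefXn; case: eqP => [E|]; last by rewrite mulr0.
case/eqP: lk; apply: val_inj => /=; apply: esym.
by rewrite -(subKn (ltnW kf)) E subKn // ltnW.
Qed.

Lemma horner_reversal u f z : z != 0 -> (reversal u f).[z] = f.[u / z] * z ^+ size f.
Proof.
move=> z0; rewrite [f.[_]]horner_coef mulr_suml horner_sum; apply: eq_bigr => k _.
have E : z ^+ size f = z ^+ k * z ^+ (size f - k) by rewrite -exprD subnKC // ltnW.
rewrite hornerZ hornerXn expr_div_n E.
by rewrite -!mulrA; congr (_ * (_ * _)); rewrite mulKf // expf_neq0.
Qed.

Lemma coefs_in_reversal u f : P u -> coefs_in P f -> coefs_in P (reversal u f).
Proof.
move=> Pu Pf; apply: coefs_in_sum => k _; apply: coefs_inZ (@coefs_inXn _).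
by apply: inM => //; apply: inX.
Qed.

(** ** Divisibility *)

Lemma unit_inM u v : unit_in P u -> unit_in P v -> unit_in P (u * v).
Proof.
by move=> [Pu Pu' u0] [Pv Pv' v0]; split; rewrite ?invfM ?mulf_neq0 //; exact: inM.
Qed.

Lemma unit_inV u : unit_in P u -> unit_in P u^-1.
Proof. by move=> [Pu Pu' u0]; split; rewrite ?invrK ?invr_eq0. Qed.

Lemma unit_inX u m : unit_in P u -> unit_in P (u ^+ m).
Proof.
move=> uU; elim: m => [|m IH]; rewrite ?exprS; last exact: unit_inM.
by split; rewrite ?invr1 ?oner_eq0 //; exact: in1.
Qed.

Lemma divides_inM a b c : P c -> divides_in P a b -> divides_in P a (c * b).
Proof. by move=> Pc [d Pd ->]; exists (c * d); [exact: inM|ring]. Qed.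

Lemma divides_inB a b c :
  divides_in P a b -> divides_in P a c -> divides_in P a (b - c).
Proof. by move=> [d Pd ->] [e Pe ->]; exists (d - e); [exact: inB|ring]. Qed.

Lemma prime_not_divides p a b : prime_in P p -> P a -> P b ->
  ~ divides_in P p a -> ~ divides_in P p b -> ~ divides_in P p (a * b).
Proof. by move=> [_ _ _ pP] Pa Pb na nb /(pP _ _ Pa Pb)[]. Qed.

Lemma prime_not_dividesX p a m :
  prime_in P p -> P a -> ~ divides_in P p a -> ~ divides_in P p (a ^+ m).
Proof.
move=> pP Pa na; elim: m => [|m IH]; first by case: pP.
by rewrite exprS; apply: prime_not_divides => //; exact: inX.
Qed.

Lemma prime_not_divides_unit p u : prime_in P p -> unit_in P u -> ~ divides_in P p u.
Proof.
move=> [_ _ p1 _] [Pu Pu' u0] [c Pc E]; apply: p1; exists (c * u^-1); first exact: inM.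
by rewrite mulrA -E divff.
Qed.

(** Each factor [p] of the denominator can be cancelled: [p] divides [b] times
    the numerator [a * p ^+ m], hence the numerator. *)
Lemma prime_clear_denominator p b a m : prime_in P p -> P b -> ~ divides_in P p b ->
  P (a * b) -> P (a * p ^+ m) -> P a.
Proof.
move=> [Pp p0 _ pP] Pb nb Pab; elim: m => [|m IH]; first by rewrite mulr1.
move=> Pa; apply: IH; have /pP : divides_in P p (b * (a * p ^+ m.+1)).
  by exists (a * b * p ^+ m); [apply/inM/inX|rewrite exprS; ring].
case=> // -[c Pc]; rewrite exprS mulrCA => /(mulfI p0) -> //.
Qed.

End Closure.

(** The localization of [P] at the powers of [z]. *)
Definition localized P z a : Prop := exists m, P (a * z ^+ m).

Lemma localized_sub P z a : P a -> localized P z a.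
Proof. by exists 0%N; rewrite mulr1. Qed.

Lemma localized_inv P z : z != 0 -> is_subring P -> localized P z z^-1.
Proof. by move=> z0 sP; exists 1%N; rewrite mulVf //; exact: in1. Qed.

Lemma localized_subring P z : is_subring P -> P z -> is_subring (localized P z).
Proof.
move=> sP Pz; split=> [|a b [m Pa] [l Pb]|a b [m Pa] [l Pb]].
- by apply: localized_sub; exact: in1.
- exists (m + l)%N; rewrite (_ : _ * _ = a * z ^+ m * z ^+ l - b * z ^+ l * z ^+ m).
    by apply: inB => //; apply: inM => //; apply: inX.
  by rewrite exprD; ring.
exists (m + l)%N; rewrite (_ : _ * _ = a * z ^+ m * (b * z ^+ l)); first exact: inM.
by rewrite exprD; ring.
Qed.

(** Inverting an element prime to [p] does not create multiples of [p]. *)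
Lemma divides_in_localized P p z a : is_subring P -> prime_in P p -> P z ->
  ~ divides_in P p z -> P a -> divides_in (localized P z) p a -> divides_in P p a.
Proof.
move=> sP pP Pz nz Pa [c [m Pc] E].
have [_ _ _ H] := pP; have : divides_in P p (a * z ^+ m).
  by exists (c * z ^+ m) => //; rewrite E mulrA.
by case/H => //; [exact: inX|move/(prime_not_dividesX sP pP Pz nz)].
Qed.

End Subring.

(** * Laurent polynomials in a tuple of field elements *)

Section LaurentRing.
Variables (S : idomainType) (n : nat) (K : fieldType) (iota : {rmorphism S -> K}).
Implicit Types (x : 'I_n -> K) (A B : pred 'I_n) (a b c u : K) (f g : {poly K}).

(** The ring of Laurent polynomials in the [x k] with [A k].  Being defined
    inside the field, it does not see the numbering of the variables. *)
Inductive laurent_in x A : K -> Prop :=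
| Laurent_const (c : S) : laurent_in x A (iota c)
| Laurent_var k : A k -> laurent_in x A (x k)
| Laurent_inv k : A k -> laurent_in x A (x k)^-1
| Laurent_add a b : laurent_in x A a -> laurent_in x A b -> laurent_in x A (a + b)
| Laurent_mul a b : laurent_in x A a -> laurent_in x A b -> laurent_in x A (a * b).

Definition off (i : 'I_n) : pred 'I_n := fun k => k != i.
Definition off2 (i j : 'I_n) : pred 'I_n := fun k => (k != i) && (k != j).

Lemma laurent_subring x A : is_subring (laurent_in x A).
Proof.
split=> [|a b La Lb|]; last exact: Laurent_mul.
  by rewrite -(rmorph1 iota); apply: Laurent_const.
apply: Laurent_add => //; rewrite -mulN1r -(rmorphN1 iota).
by apply: Laurent_mul => //; apply: Laurent_const.
Qed.
Hint Resolve laurent_subring : core.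

(** The workhorse for comparing Laurent rings: clusters related by a mutation
    share all variables but one. *)
Lemma laurent_eq x x' A B a : (forall k, A k -> B k /\ x k = x' k) ->
  laurent_in x A a -> laurent_in x' B a.
Proof.
move=> AB; elim=> {a} [c|k /AB[Bk ->]|k /AB[Bk ->]|a b _ La _ Lb|a b _ La _ Lb].
- exact: Laurent_const.
- exact: Laurent_var.
- exact: Laurent_inv.
- exact: Laurent_add.
exact: Laurent_mul.
Qed.

Lemma laurent_sub x A B a : subpred A B -> laurent_in x A a -> laurent_in x B a.
Proof. by move=> AB; apply: laurent_eq => k /AB. Qed.

Lemma laurent_all x A a : laurent_in x A a -> laurent_in x predT a.
Proof. exact: laurent_sub. Qed.

Lemma laurent_off2l x i j a : laurent_in x (off2 i j) a -> laurent_in x (off i) a.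
Proof. by apply: laurent_sub => k /andP[]. Qed.

Lemma coefs_in_sub x A B f :
  subpred A B -> coefs_in (laurent_in x A) f -> coefs_in (laurent_in x B) f.
Proof. by move=> AB Lf k; apply/(laurent_sub AB)/Lf. Qed.

Lemma unit_in_sub x A B u :
  subpred A B -> unit_in (laurent_in x A) u -> unit_in (laurent_in x B) u.
Proof. by move=> AB [? ? ?]; split=> //; apply: laurent_sub AB _. Qed.

Lemma unit_in_all x A u : unit_in (laurent_in x A) u -> unit_in (laurent_in x predT) u.
Proof. exact: unit_in_sub. Qed.

(** ** Algebraic independence *)

(** Algebraic independence, phrased with one variable at a time and with Laurent
    coefficients, which is how it is used. *)
Definition independent x : Prop :=
  forall j f, coefs_in (laurent_in x (off j)) f -> f.[x j] = 0 -> f = 0.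

Lemma independent_neq0 x j : independent x -> x j != 0.
Proof.
move=> ind; apply/eqP => xj0; have /eqP : 'X = 0 :> {poly K}.
  apply: (ind j); last by rewrite hornerX.
  exact: (coefs_inXn (laurent_subring x (off j)) 1).
by rewrite polyX_eq0.
Qed.

Lemma unit_in_var x (A : pred 'I_n) j : independent x -> A j -> unit_in (laurent_in x A) (x j).
Proof.
by move=> ind Aj; split; [exact: Laurent_var|exact: Laurent_inv|exact: independent_neq0].
Qed.

Lemma laurent_poly x A j a : independent x -> laurent_in x A a ->
  exists m f, coefs_in (laurent_in x (predI A (off j))) f /\ a * x j ^+ m = f.[x j].
Proof.
move=> ind; have xj0 := independent_neq0 j ind.
set B := predI _ _; have sB := laurent_subring x B.
elim=> {a} [c|k Ak|k Ak|a b _ [m [f [Lf E]]] _ [l [g [Lg E']]]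
  |a b _ [m [f [Lf E]]] _ [l [g [Lg E']]]].
- exists 0%N, (iota c)%:P; rewrite mulr1 hornerC.
  by split=> //; apply: coefs_inC => //; apply: Laurent_const.
- exists 0%N; rewrite mulr1; case: (eqVneq k j) => [->|kj].
    by exists 'X; rewrite hornerX; split=> //; exact: (@coefs_inXn _ _ sB 1).
  exists (x k)%:P; rewrite hornerC; split=> //; apply: coefs_inC => //.
  by apply: Laurent_var; rewrite /B /= Ak.
- case: (eqVneq k j) => [->|kj].
    exists 1%N, 1; rewrite expr1 mulVf // hornerC; split=> //; exact: (@coefs_inXn _ _ sB 0).
  exists 0%N, (x k)^-1%:P; rewrite hornerC mulr1; split=> //; apply: coefs_inC => //.
  by apply: Laurent_inv; rewrite /B /= Ak.
- exists (m + l)%N, (f * 'X^l + g * 'X^m); split.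
    by apply: coefs_inD => //; apply: coefs_inM => //; apply: coefs_inXn.
  by rewrite !hornerE -E -E' exprD; ring.
exists (m + l)%N, (f * g); split; first exact: coefs_inM.
by rewrite hornerM -E -E' exprD; ring.
Qed.

(** After multiplication by a power of [x j], both [f.[x j]] and its Laurent
    expansion are polynomials in [x j]; the common denominator [d] of the
    coefficients of [f] makes independence applicable to their difference. *)
Lemma laurent_coefs x A B j d f : independent x ->
    subpred B (off j) -> subpred (predI A (off j)) B ->
  d != 0 -> laurent_in x B d -> coefs_in (laurent_in x B) (d *: f) ->
  laurent_in x A f.[x j] -> coefs_in (laurent_in x B) f.
Proof.
move=> ind Bj AB d0 Ld Ldf /(laurent_poly j ind)[m [g [Lg E]]].
have {}Lg := coefs_in_sub AB Lg; have sB := laurent_subring x B.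
suff E' : f * 'X^m = g.
  by move=> k; have := Lg (k + m)%N; rewrite -E' coefMXn ltnNge leq_addl addnK.
have dP : d%:P != 0 by rewrite polyC_eq0.
apply/eqP; rewrite -subr_eq0 -(mulrI_eq0 _ (mulfI dP)) mul_polyC; apply/eqP.
apply: (ind j); last by rewrite !hornerE E subrr mulr0.
apply: (coefs_in_sub Bj); rewrite scalerBr; apply: coefs_inB => //.
  by rewrite scalerAl; apply: coefs_inM => //; apply: coefs_inXn.
by apply: coefs_inZ.
Qed.

(** The same with [x j] replaced by [u / x j], by reversing the polynomial. *)
Lemma laurent_coefs_inv x A B j d u f : independent x ->
    subpred B (off j) -> subpred (predI A (off j)) B -> subpred B A -> A j ->
  d != 0 -> laurent_in x B d -> coefs_in (laurent_in x B) (d *: f) ->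
  unit_in (laurent_in x B) u ->
  laurent_in x A f.[u / x j] -> coefs_in (laurent_in x B) f.
Proof.
move=> ind Bj AB BA Aj d0 Ld Ldf [Lu Lu' u0] Lfu.
have xj0 := independent_neq0 j ind.
have sA := laurent_subring x A; have sB := laurent_subring x B.
have Lg : coefs_in (laurent_in x B) (reversal u f).
  apply: (@laurent_coefs x A B j d) => //.
    rewrite scaler_sumr; apply: coefs_in_sum => // k _; rewrite scalerA mulrA.
    apply: coefs_inZ => //; last exact: coefs_inXn.
    by apply: inM => //; [have := Ldf k; rewrite coefZ|apply: inX].
  by rewrite horner_reversal //; apply: inM => //; apply: inX => //; apply: Laurent_var.
move=> k; case: (ltnP k (size f)) => kf; last by rewrite nth_default //; exact: in0.
have := Lg (size f - k)%N; rewrite coef_reversal // => H.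
rewrite -[f`_k](mulfK (expf_neq0 k u0)) -exprVn.
by apply: inM => //; apply: inX.
Qed.

(** ** Rescaled polynomials *)

(** When [a] does not involve [x i] and [c] is a unit times [1 / x i], being
    Laurent after the substitution of [c * a] for the variable can be read off
    the coefficients; this turns the condition that normalizes the exchange
    Laurent polynomials into one that no longer mentions the new variable. *)
Lemma horner_rescale f a b c :
  (\poly_(k < size f) (f`_k * a ^+ k / b)).[c] = f.[c * a] / b.
Proof.
rewrite (horner_coef_wide _ (size_poly _ _)) horner_coef mulr_suml.
by apply: eq_bigr => k _; rewrite coef_poly ltn_ord exprMn; ring.
Qed.

Lemma coef_rescale f a b k :
  (\poly_(k < size f) (f`_k * a ^+ k / b))`_k = f`_k * a ^+ k / b.
Proof. by rewrite coef_poly; case: ltnP => // le; rewrite nth_default // !mul0r. Qed.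

Lemma laurent_rescale x i j f a b c : laurent_in x predT c ->
  (forall k : nat, laurent_in x (off2 i j) (f`_k * a ^+ k / b)) ->
  laurent_in x predT (f.[c * a] / b).
Proof.
move=> Lc H; rewrite -horner_rescale; apply: in_horner => // k.
by rewrite coef_rescale; apply: laurent_all (H k).
Qed.

(** The coefficients are isolated first with respect to [x i], then, being free
    of [x j], with respect to [x j]. *)
Lemma laurent_rescaleV x i j f u a b : independent x -> i != j ->
  unit_in (laurent_in x (off i)) u -> coefs_in (laurent_in x (off2 i j)) f ->
  laurent_in x (off2 i j) a -> laurent_in x (off2 i j) b -> b != 0 ->
  laurent_in x predT (f.[u / x i * a] / b) ->
  forall k : nat, laurent_in x (off2 i j) (f`_k * a ^+ k / b).
Proof.
move=> ind ij uU Lf La Lb b0; rewrite -horner_rescale.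
set h := \poly_(k < _) _ => hL k.
have hE m : h`_m = f`_m * a ^+ m / b by apply: coef_rescale.
have bh m : laurent_in x (off2 i j) (b * h`_m).
  by rewrite hE mulrC divfK //; apply: inM => //; apply: inX.
have hV : coefs_in (laurent_in x (off i)) h.
  apply: (laurent_coefs_inv (A := predT) ind _ _ _ _ b0 _ _ uU hL) => //.
    exact: laurent_off2l Lb.
  by move=> m; rewrite coefZ; apply: laurent_off2l (bh m).
rewrite -hE; have q1 : subpred (predI (off i) (off j)) (off2 i j) by [].
have q2 : coefs_in (laurent_in x (off2 i j)) (b *: (h`_k)%:P).
  by case=> [|m]; rewrite coefZ coefC /= ?mulr0 //; exact: in0.
have q3 : laurent_in x (off i) (h`_k)%:P.[x j] by rewrite hornerC.
have q4 : subpred (off2 i j) (off j) by move=> m /andP[].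
by have := laurent_coefs ind q4 q1 b0 Lb q2 q3 0%N; rewrite coefC.
Qed.

(** ** Polynomials with at least two terms *)

(** Having a nonzero constant term, [f] is coprime to ['X]; it could divide
    [d * 'X^m] only by dividing the constant [d]. *)
Lemma not_divides_free x B j f d : independent x -> subpred B (off j) ->
  coefs_in (laurent_in x B) f -> f`_0 != 0 -> (1 < size f)%N ->
  laurent_in x B d -> d != 0 ->
  ~ divides_in (laurent_in x predT) f.[x j] d.
Proof.
move=> ind Bj Lf f0 sf Ld d0 [r /(laurent_poly j ind)[m [g [Lg E]]] dE].
have sj := laurent_subring x (off j).
have fg : f * g = d%:P * 'X^m.
  apply/eqP; rewrite -subr_eq0; apply/eqP/(ind j).
    apply: coefs_inB => //; apply: coefs_inM => //; try exact: coefs_inXn.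
      exact: coefs_in_sub Bj Lf.
    by apply: coefs_inC => //; apply: laurent_sub Bj Ld.
  by rewrite !hornerE -E dE; ring.
have : (f %| d%:P * 'X^m)%R by rewrite -fg dvdp_mulr.
rewrite Gauss_dvdpl; last first.
  by apply: coprimep_expr; rewrite -['X]subr0 -polyC0 coprimep_XsubC rootE horner_coef0.
move/dvdp_leq; rewrite polyC_eq0 size_polyC d0 => /(_ isT).
by rewrite leqNgt sf.
Qed.

End LaurentRing.
#[global] Hint Resolve laurent_subring : core.

(** * Seeds and mutations inside the field *)

Section Seeds.
Variables (S : idomainType) (n : nat) (K : fieldType) (iota : {rmorphism S -> K}).
Implicit Types (x F : 'I_n -> K) (A B : pred 'I_n) (a : K) (f g : {poly K}) (i j k : 'I_n).

Local Notation L x A := (laurent_in iota x A).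

(** A seed seen through the values [F] of its exchange polynomials.  The
    constant term in [seed_expand] is nonzero because no variable divides an
    exchange polynomial. *)
Record abstract_seed x F : Prop := AbstractSeed {
  seed_independent : independent iota x;
  seed_own i : L x (off i) (F i);
  seed_prime i : prime_in (L x predT) (F i);
  seed_expand i j : j != i ->
    exists f, [/\ coefs_in (L x (off2 i j)) f, F i = f.[x j] & f`_0 != 0] }.

(** What a mutation at [j] does to [F i] when [F i] does not depend on [x j].
    The last two conditions say that the exchange Laurent polynomial
    [x i ^ (- b) * g (x i)] of [x j] is Laurent and not divisible by [F i] after
    the substitution of [F i / x] for [x i]. *)
Definition edge_independent x F j F' i (b : nat) mu : Prop :=
  let R := L x (off2 i j) in
  [/\ R (F i), exists2 v, unit_in R v & F' i = v * F i &
      exists g, [/\ coefs_in R g, mu * F j = g.[x i],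
        forall k : nat, R (g`_k * F i ^+ k / F i ^+ b) &
        ~ forall k : nat, R (g`_k * F i ^+ k / F i ^+ b.+1)]].

(** What a mutation at [j] does to [F i] when [F i] depends on [x j].  The old
    and the new exchange polynomial, [f] and [f'], determine each other up to
    powers of the variable and factors free of [x i] and [x j], through the
    inversion [z |-> g`_0 / z].  Since it holds for all [z], and not only for
    the new variable, this relation can be read in both directions. *)
Definition edge_dependent x F j x' F' i mu : Prop :=
  let R := L x (off2 i j) in
  exists f f' g, [/\
    [/\ coefs_in R f, F i = f.[x j], f`_0 != 0 & (1 < size f)%N],
    [/\ coefs_in R f', F' i = f'.[x' j], f'`_0 != 0 & (1 < size f')%N],
    [/\ coefs_in R g, mu * F j = g.[x i] & g`_0 != 0] &
    exists d d' (c c' : nat), [/\ R d, R d', d != 0, d' != 0 &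
      forall z, z != 0 -> d' * z ^+ c' * f'.[z] = d * z ^+ c * f.[g`_0 / z]]].

Record edge x F j x' F' : Prop := Edge {
  edge_other k : k != j -> x' k = x k;
  edge_exch : F' j = F j;
  edge_own : exists2 u, unit_in (L x (off j)) u & x j * x' j = u * F j;
  edge_dir i : i != j -> exists b mu,
    [/\ unit_in (L x (off2 i j)) mu, x j * x' j * x i ^+ b = mu * F j &
        edge_independent x F j F' i b mu \/
        b = 0%N /\ edge_dependent x F j x' F' i mu] }.

Lemma off2C i j : off2 i j =1 off2 j i.
Proof. by move=> k; rewrite /off2 andbC. Qed.

Lemma edge_laurent x F j x' F' A a : edge x F j x' F' -> subpred A (off j) ->
  L x A a <-> L x' A a.
Proof.
move=> e Aj; split; apply: laurent_eq => k Ak; split=> //.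
  by rewrite (edge_other e) //; apply: Aj.
by rewrite (edge_other e) //; apply: Aj.
Qed.

Lemma edge_unit x F j x' F' A a : edge x F j x' F' -> subpred A (off j) ->
  unit_in (L x A) a <-> unit_in (L x' A) a.
Proof.
move=> e Aj; split=> -[La La' a0]; split=> //; first exact/(edge_laurent _ e Aj).
- exact/(edge_laurent _ e Aj).
- exact/(edge_laurent _ e Aj).
exact/(edge_laurent _ e Aj).
Qed.

Lemma edge_coefs x F j x' F' A f : edge x F j x' F' -> subpred A (off j) ->
  coefs_in (L x A) f <-> coefs_in (L x' A) f.
Proof. by move=> e Aj; split=> Lf k; apply/(edge_laurent _ e Aj); apply: Lf. Qed.

Lemma off2_sub i j : subpred (off2 i j) (off j). Proof. by move=> k /andP[]. Qed.
Lemma off2_subl i j : subpred (off2 i j) (off i). Proof. by move=> k /andP[]. Qed.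

(** In the dependent case, substitute [g`_0 / z] for [z] in the relation between
    [f] and [f'] and clear denominators. *)
Lemma edge_sym x F j x' F' : edge x F j x' F' -> edge x' F' j x F.
Proof.
move=> e; have ex := edge_other e.
have lE i := edge_laurent _ e (@off2_sub i j); have cE i := edge_coefs _ e (@off2_sub i j).
split=> [k kj||| i ij].
- by rewrite ex.
- by rewrite (edge_exch e).
- have [u uU E] := edge_own e; exists u; last by rewrite mulrC E (edge_exch e).
  exact/(edge_unit _ e).
have [b [mu [muU E H]]] := edge_dir e ij; exists b, mu; split.
- by rewrite -(edge_unit _ e) //; apply: off2_sub.
- by rewrite (ex i ij) (edge_exch e) -E; ring.
case: H => [[LF [v [Lv Lv' v0] vE] [g [Lg gE H1 H2]]]|[-> H]]; [left|right].
  have lE' (k : nat) : L x (off2 i j) (g`_k * F' i ^+ k / F' i ^+ b) /\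
    (L x (off2 i j) (g`_k * F' i ^+ k / F' i ^+ b.+1) <->
     L x (off2 i j) (g`_k * F i ^+ k / F i ^+ b.+1)).
    have sR := laurent_subring iota x (off2 i j).
    have vX m l : unit_in (L x (off2 i j)) (v ^+ m / v ^+ l).
      by apply: unit_inM => //; [|apply: unit_inV]; apply: unit_inX.
    have vxE m : g`_k * F' i ^+ k / F' i ^+ m = v ^+ k / v ^+ m * (g`_k * F i ^+ k / F i ^+ m).
      by rewrite vE !exprMn invfM; ring.
    rewrite !vxE; split; first by apply: inM => //; case: (vX k b).
    have [La La' a0] := vX k b.+1.
    split=> H; last by apply: inM.
    by rewrite -[_ / _](mulKf a0); apply: inM.
  split.
  - by rewrite vE -lE; apply: inM.
  - exists v^-1; last by rewrite vE mulKf.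
    by rewrite -(edge_unit _ e); [split; rewrite ?invrK ?invr_eq0|apply: off2_sub].
  exists g; split=> [||k|H].
  - exact/cE.
  - by rewrite (edge_exch e) (ex i ij).
  - by rewrite -lE; case: (lE' k).
  by apply: H2 => k; apply/(lE' k).2/lE.
split=> //; have [f [f' [g [[Lf fE f0 sf] [Lf' f'E f'0 sf'] [Lg gE g0]]]]] := H.
move=> [d [d' [c [c' [Ld Ld' d0 d'0 dE]]]]].
exists f', f, g; split.
- by split=> //; apply/cE.
- by split=> //; apply/cE.
- by split; [apply/cE|rewrite (edge_exch e) (ex i ij)|].
have sR := laurent_subring iota x (off2 i j).
exists (d' * g`_0 ^+ c'), (d * g`_0 ^+ c), c, c'; split; last first.
- move=> z z0; have := dE (g`_0 / z); rewrite mulf_neq0 ?invr_eq0 // => /(_ isT).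
  rewrite invf_div mulrCA divff // mulr1 !expr_div_n.
  move/(congr1 ( *%R (z ^+ c * z ^+ c'))).
  have zc := expf_neq0 c z0; have zc' := expf_neq0 c' z0 => E'.
  transitivity (z ^+ c * z ^+ c' * (d * (g`_0 ^+ c / z ^+ c) * f.[z])).
    by field.
  by rewrite -E'; field.
- by rewrite mulf_neq0 // expf_neq0.
- by rewrite mulf_neq0 // expf_neq0.
- by apply/lE; apply: inM => //; apply: inX.
by apply/lE; apply: inM => //; apply: inX.
Qed.

End Seeds.

(** * Divisibility along two and three mutations *)

Section Steps.
Variables (S : idomainType) (n : nat) (K : fieldType) (iota : {rmorphism S -> K}).
Implicit Types (x F : 'I_n -> K) (A B : pred 'I_n) (a : K) (f g : {poly K}) (i j : 'I_n).

Local Notation L x A := (laurent_in iota x A).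
Local Notation seed := (abstract_seed iota).
Local Notation edge := (edge iota).

(** Up to a unit of the Laurent ring, the new variable is the exchange polynomial. *)
Lemma first_step x0 F0 x1 F1 i : seed x0 F0 -> edge x0 F0 i x1 F1 ->
  exists u, [/\ unit_in (L x0 (off i)) u, unit_in (L x0 predT) (u / x0 i) &
    x1 i = u / x0 i * F0 i].
Proof.
move=> s0 e; have ind := seed_independent s0; have x0i := independent_neq0 i ind.
have [u uU E] := edge_own e; exists u; split=> //.
  by apply: unit_inM => //; [exact: unit_in_all uU|apply: unit_inV; exact: unit_in_var].
by apply: (mulfI x0i); rewrite E; field.
Qed.

(** If [F1 i] does not depend on [x j], this restates the normalization of the
    exchange Laurent polynomial.  Otherwise [x1 j * x2 j] is a polynomial in
    [x1 i], which is a multiple of [F0 i]; its constant term is not, being free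
    of [x j]. *)
Lemma second_step x0 F0 x1 F1 x2 F2 i j : i != j ->
  seed x0 F0 -> edge x0 F0 i x1 F1 -> edge x1 F1 j x2 F2 ->
  L x0 predT (x2 j) /\ ~ divides_in (L x0 predT) (F0 i) (x2 j).
Proof.
move=> ij s0 e01 e12; have ind := seed_independent s0.
have x0i := independent_neq0 i ind.
have sL := laurent_subring iota x0 predT.
have [u [uU vU yE]] := first_step s0 e01; move vE: (u / x0 i) vU yE => v vU yE.
have [F0L F00 _ _] := seed_prime s0 i.
have FE := edge_exch e01.
have tE : x1 j = x0 j by rewrite (edge_other e01) // eq_sym.
have tU : unit_in (L x0 predT) (x0 j) by apply: unit_in_var.
have t0 : x0 j != 0 by case: tU.
have R01 a := edge_laurent a e01 (@off2_subl _ i j).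
have [b [mu [muU zE [[RF _ [g [Rg gE g1 g2]]]|[b0 H]]]]] := edge_dir e12 ij.
  (* Used with m = b for the first claim and m = b + 1 for the second. *)
  have x2E m : x2 j = (x0 j)^-1 / v ^+ b *
      (g.[v * F0 i] / F0 i ^+ m * (F0 i ^+ m / F0 i ^+ b)).
    have v0 : v != 0 by case: vU.
    have vb := expf_neq0 b v0; have Fb := expf_neq0 b F00; have Fm := expf_neq0 m F00.
    apply: (mulfI t0); apply: (mulIf vb); apply: (mulIf Fb).
    rewrite -yE -gE -zE tE yE exprMn; field.
    by rewrite t0 vb Fm Fb.
  have wU : unit_in (L x0 predT) ((x0 j)^-1 / v ^+ b).
    by apply: unit_inM => //; [exact: unit_inV|apply/unit_inV/unit_inX].
  have [wL wL' w0] := wU; have [vL _ _] := vU.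
  split.
    rewrite (x2E b) divff ?expf_neq0 // mulr1; apply: inM => //.
    by apply: (@laurent_rescale _ _ _ _ _ i j) => // k; rewrite -FE; apply/R01/g1.
  move=> [r rL rE]; have FR : L x0 (off2 i j) (F0 i) by apply/R01; rewrite -FE.
  apply: g2 => k; rewrite FE; apply/R01; apply: (laurent_rescaleV ind ij uU) => //.
  - by move=> m; apply/R01/Rg.
  - exact: inX.
  - by rewrite expf_neq0.
  rewrite vE (_ : _ / _ = ((x0 j)^-1 / v ^+ b)^-1 * r); first exact: inM.
  apply: (mulfI w0); rewrite mulVKf //; apply: (mulfI F00).
  rewrite -rE (x2E b.+1) exprS; field.
  by rewrite t0 F00 !expf_neq0 //; case: vU.
have [f [_ [g [[Rf fE f0 sf] _ [Rg gE g0] _]]]] := H.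
have Rg0 : L x0 (off2 i j) g`_0 by apply/R01/Rg.
have {}Rg : coefs_in (L x0 predT) g by move=> k; apply/laurent_all/R01/Rg.
have {}Rf : coefs_in (L x0 (off2 i j)) f by move=> k; apply/R01/Rf.
have yL : L x0 predT (x1 i) by rewrite yE; apply: inM => //; case: vU.
rewrite b0 mulr1 gE tE in zE.
have x2E : x2 j = (x0 j)^-1 * g.[x1 i] by rewrite -zE mulKf.
have [_ tV _] := tU.
have [c Lc gs] := horner_split sL Rg yL.
split; first by rewrite x2E; apply: inM => //; apply: in_horner.
rewrite -FE fE tE => Fz; apply: (not_divides_free ind (@off2_sub _ i j) Rf f0 sf Rg0 g0).
rewrite -tE -fE FE in Fz *.
have -> : g`_0 = x0 j * x2 j - x1 i * (g`_1 + x1 i * c) by rewrite x2E mulVKf // gs; ring.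
apply: divides_inB => //; first by apply: divides_inM => //; case: tU.
rewrite yE -mulrA mulrCA; exists (v * (g`_1 + x1 i * c)); rewrite -?yE //.
apply: inM => //; first by case: vU.
by apply: inD => //; apply: inM.
Qed.

(** Only the powers of the new variable are missing from the old Laurent ring. *)
Lemma pullback x0 F0 x1 F1 i a : seed x0 F0 -> edge x0 F0 i x1 F1 ->
  L x1 predT a -> exists m, L x0 predT (a * F0 i ^+ m).
Proof.
move=> s0 e01 La; have sL := laurent_subring iota x0 predT.
have [F0L _ _ _] := seed_prime s0 i.
have [u [_ [vL vL' v0] yE]] := first_step s0 e01.
elim: La => {a} [c|k _|k _|a b _ [m La] _ [l Lb]|a b _ [m La] _ [l Lb]].
- by exists 0%N; rewrite mulr1; apply: Laurent_const.
- exists 0%N; rewrite mulr1; case: (eqVneq k i) => [->|ki]; first by rewrite yE; apply: inM.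
  by rewrite (edge_other e01) //; apply: Laurent_var.
- case: (eqVneq k i) => [->|ki].
    have [_ F00 _ _] := seed_prime s0 i.
    by exists 1%N; rewrite yE invfM -mulrA mulVf // mulr1.
  by exists 0%N; rewrite mulr1 (edge_other e01) //; apply: Laurent_inv.
- exists (m + l)%N.
  rewrite (_ : _ * _ = a * F0 i ^+ m * F0 i ^+ l + b * F0 i ^+ l * F0 i ^+ m).
    by apply: inD => //; apply: inM => //; apply: inX.
  by rewrite exprD; ring.
exists (m + l)%N; rewrite (_ : _ * _ = a * F0 i ^+ m * (b * F0 i ^+ l)); first exact: inM.
by rewrite exprD; ring.
Qed.

(** Write [y = x1 i], [z = x2 j], [w = x3 i] and [t = x0 j].  In the independent
    case [w * z ^ b] is a unit.  In the dependent case [w] is, up to factors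
    prime to [F0 i], the quotient by [F0 i] of [f (g`_0 / z)], where
    [g`_0 / z = t - y * eps / z]; the Taylor expansion at [t] starts with
    [f t = F0 i], and the quotient [E] has denominators only in [z].  As [w] is
    also Laurent in [x1], it belongs to the Laurent ring of [x0]. *)
Lemma third_step x0 F0 x1 F1 x2 F2 x3 F3 i j : i != j ->
  seed x0 F0 -> seed x1 F1 ->
  edge x0 F0 i x1 F1 -> edge x1 F1 j x2 F2 -> edge x2 F2 i x3 F3 ->
  L x0 predT (x3 i) /\ ~ divides_in (L x0 predT) (F0 i) (x3 i).
Proof.
move=> ij s0 s1 e01 e12 e23; have ji : j != i by rewrite eq_sym.
have [zL nz] := second_step ij s0 e01 e12.
have [wL1 _] := second_step ji s1 e12 e23.
have [N wN] := pullback s0 e01 wL1.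
have ind := seed_independent s0.
have x0i := independent_neq0 i ind.
have sL := laurent_subring iota x0 predT.
have [u [uU vU yE]] := first_step s0 e01; move vE: (u / x0 i) vU yE => v vU yE.
have pF := seed_prime s0 i; have [F0L F00 _ _] := pF.
have FE := edge_exch e01.
have tE : x1 j = x0 j by rewrite (edge_other e01).
have R01 a := edge_laurent a e01 (@off2_subl _ i j).
have U01 a := edge_unit a e01 (@off2_subl _ i j).
have R12 a := edge_laurent a e12 (@off2_sub _ i j).
have U12 a := edge_unit a e12 (@off2_sub _ i j).
have z0 : x2 j != 0.
  by apply/eqP => z0; apply: nz; rewrite z0; exists 0; [exact: in0|rewrite mulr0].
have [vL vL' v0] := vU.
have [b [nu [nuU wE _]]] := edge_dir e23 ji.
have {}nuU : unit_in (L x0 (off2 i j)) nu.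
  by apply/U01/U12; apply: unit_in_sub nuU => k; rewrite off2C.
have nuL := unit_in_all nuU.
rewrite (edge_other e12) // yE in wE.
have [b' [mu [muU zE [[RF [v' v'U v'E] _]|[b0 H]]]]] := edge_dir e12 ij.
  have {}v'U : unit_in (L x0 predT) v' by apply/unit_in_all/U01/v'U.
  (* The factors F0 i cancel out, since F2 i is F0 i up to a unit. *)
  have epsE : x3 i * x2 j ^+ b = nu * v' / v.
    apply: (mulfI F00); apply: (mulfI v0); rewrite !mulrA [v * F0 i * _]mulrC in wE *.
    by rewrite wE v'E FE; field.
  have epsU : unit_in (L x0 predT) (nu * v' / v).
    by apply: unit_inM => //; [exact: unit_inM|exact: unit_inV].
  split; last first.
    move=> Fw; apply: (prime_not_divides_unit sL pF epsU).
    by rewrite -epsE mulrC; apply: divides_inM => //; apply: inX.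
  apply: (prime_clear_denominator sL pF (b := x2 j ^+ b) _ _ _ wN).
  - exact: inX.
  - exact: prime_not_dividesX.
  by rewrite epsE; case: epsU.
have [f [f' [g [[Rf fE f0 sf] [_ f'E _ _] [Rg gE g0]]]]] := H.
move=> [d [d' [c [c' [Rd Rd' d0 d'0 /(_ _ z0)]]]]].
rewrite -f'E => dE.
have {}Rf : coefs_in (L x0 (off2 i j)) f by move=> k; apply/R01/Rf.
have {}Rg k : L x0 (off2 i j) g`_k by apply/R01/Rg.
have {}Rd : L x0 (off2 i j) d by apply/R01.
have {}Rd' : L x0 (off2 i j) d' by apply/R01.
have nfree e : L x0 (off2 i j) e -> e != 0 -> ~ divides_in (L x0 predT) (F0 i) e.
  move=> Re e0; rewrite -FE fE tE.
  exact: (not_divides_free ind (@off2_sub _ i j) Rf f0 sf Re e0).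
have t0 := independent_neq0 j ind.
have [tL tL' _] : unit_in (L x0 predT) (x0 j) by apply: unit_in_var.
have yL : L x0 predT (x1 i) by rewrite yE; apply: inM.
have gL : coefs_in (L x0 predT) g by move=> k; apply: laurent_all.
have [e eL gs] := horner_split sL gL yL.
pose eps := g`_1 + x1 i * e.
have epsL : L x0 predT eps by apply: inD => //; apply: inM.
rewrite b0 mulr1 gE tE in zE.
have tzE : x0 j * x2 j = g`_0 + x1 i * eps by rewrite zE gs /eps; ring.
pose P := localized (L x0 predT) (x2 j).
have sP : is_subring P by apply: localized_subring.
have LP a : L x0 predT a -> P a by apply: localized_sub.
have Pz' : P (x2 j)^-1 by apply: localized_inv.
have Pf : coefs_in P f by move=> k; apply/LP/laurent_all/Rf.
have Pbeta : P (- (x1 i * eps / x2 j)).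
  by apply: inN => //; apply: inM => //; apply: LP; apply: inM.
have [r Pr tay] := taylor sP Pf (LP _ tL) Pbeta.
have arg : g`_0 / x2 j = x0 j + - (x1 i * eps / x2 j).
  by apply: (mulIf z0); rewrite mulrDl mulNr !divfK // tzE; ring.
have fF : f.[x0 j] = F0 i by rewrite -tE -fE FE.
(* The value of f at g`_0 / z, divided by F0 i. *)
pose E := 1 - v * eps / x2 j * f^`().[x0 j] + v ^+ 2 * F0 i * (eps / x2 j) ^+ 2 * r.
have fE' : f.[g`_0 / x2 j] = F0 i * E.
  by rewrite arg tay fF yE /E; ring.
have Pf' : P f^`().[x0 j] by apply: in_horner => //; [exact: coefs_in_deriv|exact: LP].
have PE : P E.
  have Pq : P (eps / x2 j) by apply: inM => //; apply: LP.
  apply: inD => //; last first.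
    apply: inM => //; apply: inM => //; last exact: inX.
    by apply: LP; apply: inM => //; apply: inX.
  apply: inB => //; [exact: in1|apply: inM => //; rewrite -mulrA; apply: inM => //; exact: LP].
have key : x3 i * (d' * x2 j ^+ (c' + b)) = v^-1 * nu * d * x2 j ^+ c * E.
  apply: (mulfI F00); apply: (mulfI v0).
  transitivity (d' * x2 j ^+ c' * (v * F0 i * x3 i * x2 j ^+ b)); first by rewrite exprD; ring.
  rewrite wE; transitivity (nu * (d' * x2 j ^+ c' * F2 i)); first by ring.
  by rewrite dE fE'; field.
have nuP : P nu by case: nuL => /LP.
have [m wm] : P (x3 i * (d' * x2 j ^+ (c' + b))).
  have Pd : P d by apply/LP/laurent_all/Rd.
  rewrite key; apply: inM => //; apply: inM => //; last by apply: inX => //; apply: LP.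
  by apply: inM => //; apply: inM => //; apply: LP.
have d'L := laurent_all Rd'.
split.
  apply: (prime_clear_denominator sL pF (b := d' * x2 j ^+ (c' + b) * x2 j ^+ m) _ _ _ wN).
  - by apply: inM => //; [apply: inM => //|]; apply: inX.
  - have nd' := nfree _ Rd' d'0; rewrite -mulrA -exprD.
    by apply: prime_not_divides => //; [exact: inX|exact: prime_not_dividesX].
  by rewrite mulrA.
move=> Fw.
(* z * d * E modulo F0 i: as z = g`_0 / t and eps = g`_1 modulo y, what is left is
   linear in v = u / x0 i. *)
pose X := d * ((x0 j)^-1 * g`_0 - v * g`_1 * f^`().[x0 j]).
have dL := laurent_all Rd; have g0L := laurent_all (Rg 0%N); have g1L := laurent_all (Rg 1%N).
have f'L : L x0 predT f^`().[x0 j].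
  by apply: in_horner => //; apply: coefs_in_deriv => // k; apply/laurent_all/Rf.
have XL : L x0 predT X.
  by apply: inM => //; apply: inB => //; apply: inM => //; apply: inM.
have : divides_in P (F0 i) X.
  have [nu1 nu2 nu0] := nuL.
  have FdE : divides_in P (F0 i) (d * (x2 j * E)).
    have [q qL qE] := Fw; rewrite qE in key.
    exists (v / nu * q * (d' * x2 j ^+ (c' + b)) * (x2 j)^-1 ^+ c * x2 j).
      have Pz := LP _ zL; apply: inM => //; apply: inM => //; last exact: inX.
      by apply: LP; do 2![apply: inM => //]; [apply: inM|apply: inX].
    have zc : x2 j ^+ c != 0 by rewrite expf_neq0.
    rewrite exprVn; transitivity
      (v / nu * (F0 i * q * (d' * x2 j ^+ (c' + b))) / x2 j ^+ c * x2 j); last by ring.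
    by rewrite key; field; rewrite zc v0 nu0.
  have -> : X = d * (x2 j * E) - F0 i * (d * ((x0 j)^-1 * v * eps - v * v * e * f^`().[x0 j]
       + v ^+ 2 * (eps / x2 j) ^+ 2 * r * x2 j)).
    rewrite /X; have -> : g`_0 = x0 j * x2 j - x1 i * eps by rewrite tzE; ring.
    have -> : g`_1 = eps - x1 i * e by rewrite /eps; ring.
    by rewrite /E yE; field; rewrite t0 z0.
  apply: divides_inB => //; eexists; last by reflexivity.
  have [Pd Pv] := (LP _ dL, LP _ vL).
  apply: inM => //; apply: inD => //.
    apply: inB => //; apply: LP; first by apply: inM => //; apply: inM.
    by do 2![apply: inM => //]; apply: inM.
  apply: inM => //; last exact: LP.
  apply: inM => //; apply: inM => //; first exact: inX.
  by apply: inX => //; apply: inM => //; apply: LP.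
move/(divides_in_localized sL pF zL nz XL) => [q qL qE].
(* x0 i * X is al * x0 i - be; F0 i, free of x0 i, must divide al. *)
pose al := d * (x0 j)^-1 * g`_0; pose be := d * u * g`_1 * f^`().[x0 j].
have F0V := seed_own s0 i.
have sV := laurent_subring iota x0 (off i).
have R_V a : L x0 (off2 i j) a -> L x0 (off i) a by apply: laurent_off2l.
have [uL _ _] := uU.
have alV : L x0 (off i) al.
  apply: inM => //; last exact: R_V.
  by apply: inM => //; [exact: R_V|apply: Laurent_inv].
have beV : L x0 (off i) be.
  apply: inM => //; first by do 2?[apply: inM => //]; apply: R_V.
  apply: in_horner => //; last exact: Laurent_var.
  by apply: coefs_in_deriv => // k; apply: R_V.
pose h := (F0 i)^-1 *: (al *: 'X - be%:P).
have hq : h.[x0 i] = x0 i * q.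
apply: (mulfI F00); rewrite mulrCA -qE /h hornerZ hornerD hornerN hornerZ hornerX.
  rewrite hornerC /X /al /be -vE; field.
  by rewrite F00 x0i t0.
have hV : coefs_in (L x0 (off i)) (F0 i *: h).
  rewrite scalerA divff // scale1r; apply: coefs_inB => //; last exact: coefs_inC.
  by apply: coefs_inZ => //; exact: (coefs_inXn _ 1).
have hL : L x0 predT h.[x0 i] by rewrite hq; apply: inM => //; exact: Laurent_var.
have /(_ 1%N) := laurent_coefs ind (fun k (ki : off i k) => ki)
  (fun k (ki : predI predT (off i) k) => ki) F00 F0V hV hL.
rewrite coefZ coefB coefZ coefX coefC /= mulr1 subr0 => alF.
apply: (nfree (d * g`_0)); [exact: inM|by rewrite mulf_neq0|].
exists (x0 j * ((F0 i)^-1 * al)); first by apply: inM => //; exact: laurent_all alF.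
by rewrite /al; field; rewrite t0.
Qed.

End Steps.

(** * The Laurent phenomenon for a collection closed under mutation *)

Section Phenomenon.
Variables (S : idomainType) (n : nat) (K : fieldType) (iota : {rmorphism S -> K}).
Implicit Types (x F y : 'I_n -> K) (A B : pred 'I_n) (a : K) (i j k : 'I_n).

Local Notation L x A := (laurent_in iota x A).
Local Notation seed := (abstract_seed iota).
Local Notation edge := (edge iota).

Lemma laurent_closed x P a : is_subring P -> (forall c, P (iota c)) ->
  (forall k, P (x k)) -> (forall k, P (x k)^-1) -> L x predT a -> P a.
Proof.
move=> sP Pc Px Px'; elim=> // {}a b _ Pa _ Pb; first exact: inD.
exact: inM.
Qed.

(** Two mutations in the same direction restore the variable up to a unit, by
    which the Laurent ring is not affected. *)
Lemma backtrack x0 F0 x1 F1 x2 F2 i a : seed x0 F0 ->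
  edge x0 F0 i x1 F1 -> edge x1 F1 i x2 F2 -> L x2 predT a -> L x0 predT a.
Proof.
move=> s0 e01 e12; have ind := seed_independent s0; have x0i := independent_neq0 i ind.
have [u uU E] := edge_own e01; have [v vU E'] := edge_own e12.
have [F0L F00 _ _] := seed_prime s0 i.
have [u0 v0] : u != 0 /\ v != 0 by case: uU vU => _ _ ? [].
have sL := laurent_subring iota x0 predT.
have vU0 : unit_in (L x0 (off i)) v by apply/(edge_unit _ e01).
have x2U : unit_in (L x0 predT) (x2 i).
  have -> : x2 i = v / u * x0 i.
    rewrite (edge_exch e01) in E'.
    have x10 : x1 i != 0.
      have : u * F0 i != 0 by rewrite mulf_neq0.
      by rewrite -E mulf_eq0 negb_or => /andP[].
    apply: (mulfI x10); rewrite E'; apply: (mulfI u0).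
    by rewrite mulrCA -E; field.
  apply: unit_inM => //; last exact: unit_in_var.
  by apply: unit_inM => //; [|apply: unit_inV]; apply: unit_in_all; [exact: vU0|exact: uU].
apply: laurent_closed => // [c|k|k]; first exact: Laurent_const.
  case: (eqVneq k i) => [->|ki]; first by case: x2U.
  by rewrite (edge_other e12) // (edge_other e01) //; exact: Laurent_var.
case: (eqVneq k i) => [->|ki]; first by case: x2U.
by rewrite (edge_other e12) // (edge_other e01) //; exact: Laurent_inv.
Qed.

(** The induction step: the variables inverted in [x3] but not in [x0] are
    [x2 j] and [x3 i], both prime to [F0 i]. *)
Lemma laurent_intersection x0 F0 x1 F1 x2 F2 x3 F3 i j a : i != j ->
  seed x0 F0 -> seed x1 F1 ->
  edge x0 F0 i x1 F1 -> edge x1 F1 j x2 F2 -> edge x2 F2 i x3 F3 ->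
  L x1 predT a -> L x3 predT a -> L x0 predT a.
Proof.
move=> ij s0 s1 e01 e12 e23 L1 L3; have ind := seed_independent s0.
have [zL nz] := second_step ij s0 e01 e12.
have [wL nw] := third_step ij s0 s1 e01 e12 e23.
have sL := laurent_subring iota x0 predT; have pF := seed_prime s0 i.
have nonzero b : ~ divides_in (L x0 predT) (F0 i) b -> b != 0.
  by move=> nb; apply/eqP => b0; apply: nb; rewrite b0; exists 0; [exact: in0|rewrite mulr0].
have [z0 w0] := (nonzero _ nz, nonzero _ nw).
have zwL : L x0 predT (x2 j * x3 i) by apply: inM.
have nzw := prime_not_divides pF zL wL nz nw.
have x3j : x3 j = x2 j by rewrite (edge_other e23) // eq_sym.
have x3E k : k != i -> k != j -> x3 k = x0 k.
  by move=> ki kj; rewrite (edge_other e23) // (edge_other e12) // (edge_other e01).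
have [m am] : localized (L x0 predT) (x2 j * x3 i) a.
  apply: laurent_closed L3 => [|c|k|k].
  - exact: localized_subring.
  - by apply: localized_sub; apply: Laurent_const.
  - case: (eqVneq k i) => [->|ki]; first by apply: localized_sub.
    apply: localized_sub; case: (eqVneq k j) => [->|kj]; first by rewrite x3j.
    by rewrite x3E //; exact: Laurent_var.
  case: (eqVneq k i) => [->|ki]; first by exists 1%N; rewrite mulrCA mulVf // mulr1.
  case: (eqVneq k j) => [->|kj]; first by exists 1%N; rewrite x3j mulKf.
  by rewrite (x3E k) //; apply: localized_sub; exact: Laurent_inv.
have [N aN] := pullback s0 e01 L1.
apply: (prime_clear_denominator sL pF _ _ am aN); first exact: inX.
exact: prime_not_dividesX.
Qed.

Variable C : ('I_n -> K) -> ('I_n -> K) -> Prop.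
Hypothesis C_seed : forall x F, C x F -> seed x F.
Hypothesis C_mutation : forall x F i, C x F -> exists x' F', C x' F' /\ edge x F i x' F'.

Fixpoint reach m x F y : Prop :=
  C x F /\ if m is m'.+1 then exists i x' F', edge x F i x' F' /\ reach m' x' F' y
           else y =1 x.

Lemma reach_start m x F y : reach m x F y -> C x F.
Proof. by case: m => [|m] []. Qed.

(** The neighbour [x3] of [x2] gives a second path to the same end, one step
    shorter than the given one. *)
Theorem reach_laurent m x F y k : reach m x F y -> L x predT (y k).
Proof.
elim/ltn_ind: m x F => -[|[|m]] IH x F.
- by move=> [_ ->]; apply: Laurent_var.
- move=> [/C_seed s0 [i [x' [F' [e [_ ->]]]]]].
  case: (eqVneq k i) => [->|ki]; last by rewrite (edge_other e) //; apply: Laurent_var.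
  have [u [_ [vL _ _] ->]] := first_step s0 e.
  by have [FL _ _ _] := seed_prime s0 i; apply: inM.
move=> [/C_seed s0 [i [x1 [F1 [e01 r1]]]]]; have c1 := @reach_start m.+1 _ _ _ r1.
have [_ [j [x2 [F2 [e12 r2]]]]] := r1; have c2 := @reach_start m _ _ _ r2.
case: (eqVneq i j) e12 => [<-|ij] e12.
  by apply: (backtrack s0 e01 e12); apply: (IH m _ _ F2).
have [x3 [F3 [c3 e23]]] := C_mutation i c2.
apply: (laurent_intersection ij s0 (C_seed c1) e01 e12 e23); first exact: (IH m.+1 _ _ F1).
by apply: (IH m.+1 _ _ F3) => //=; split=> //; exists i, x2, F2; split=> //; apply: edge_sym.
Qed.

End Phenomenon.

(** ** Renumbering *)

Section Relabel.
Variables (S : idomainType) (n : nat) (K : fieldType) (iota : {rmorphism S -> K}).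
Implicit Types (x F y G : 'I_n -> K) (A B : pred 'I_n) (a : K) (i j k : 'I_n).
Variable s : 'S_n.

Local Notation L x A := (laurent_in iota x A).
Local Notation t := (s^-1)%g.

Lemma laurent_relabel x y A B a : (forall k, y k = x (s k)) ->
  (forall k, A (s k) -> B k) -> L x A a -> L y B a.
Proof.
move=> yx AB; have xy k : x k = y (t k) by rewrite yx permKV.
have BA k : A k -> B (t k) by move=> Ak; apply: AB; rewrite permKV.
elim=> {a} [c|k Ak|k Ak|a b _ La _ Lb|a b _ La _ Lb].
- exact: Laurent_const.
- by rewrite xy; apply/Laurent_var/BA.
- by rewrite xy; apply/Laurent_inv/BA.
- exact: Laurent_add.
exact: Laurent_mul.
Qed.

Lemma laurent_relabelV x y A B a : (forall k, y k = x (s k)) ->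
  (forall k, B k -> A (s k)) -> L y B a -> L x A a.
Proof.
move=> yx BA; elim=> {a} [c|k Ak|k Ak|a b _ La _ Lb|a b _ La _ Lb].
- exact: Laurent_const.
- by rewrite yx; apply/Laurent_var/BA.
- by rewrite yx; apply/Laurent_inv/BA.
- exact: Laurent_add.
exact: Laurent_mul.
Qed.

Lemma laurent_relabelE x y A B : (forall k, y k = x (s k)) ->
  (forall k, B k = A (s k)) -> laurent_in iota y B = laurent_in iota x A.
Proof.
move=> yx BA; apply: functional_extensionality => a.
apply: propositional_extensionality; split.
  by apply: laurent_relabelV => // k; rewrite BA.
by apply: laurent_relabel => // k; rewrite BA.
Qed.


Lemma off_relabel i k : off (t i) k = off i (s k).
Proof. by rewrite /off -(inj_eq (@perm_inj _ s)) permKV. Qed.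

Lemma off2_relabel i j k : off2 (t i) (t j) k = off2 i j (s k).
Proof. by congr (_ && _); apply: off_relabel. Qed.

Lemma seed_relabel x F y G : (forall k, y k = x (s k)) -> (forall k, G k = F (s k)) ->
  abstract_seed iota x F -> abstract_seed iota y G.
Proof.
move=> yx GF [ind own pr ex].
have offE i : L y (off i) = L x (off (s i)).
  by apply: laurent_relabelE => // k; rewrite -off_relabel permK.
have off2E i j : L y (off2 i j) = L x (off2 (s i) (s j)).
  by apply: laurent_relabelE => // k; rewrite -off2_relabel !permK.
have allE : L y predT = L x predT by apply: laurent_relabelE.
split=> [j f|i|i|i j ji]; rewrite ?offE ?off2E ?allE ?yx ?GF //.
  exact: ind.
by apply: ex; rewrite (inj_eq perm_inj).
Qed.

Lemma edge_relabel x F i x' F' y G y' G' :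
  (forall k, y k = x (s k)) -> (forall k, G k = F (s k)) ->
  (forall k, y' k = x' (s k)) -> (forall k, G' k = F' (s k)) ->
  edge iota x F i x' F' -> edge iota y G (t i) y' G'.
Proof.
move=> yx GF yx' GF' [e1 e2 e3 e4].
have offE : L y (off (t i)) = L x (off i).
  by apply: laurent_relabelE => // k; rewrite off_relabel.
have off2E k : L y (off2 k (t i)) = L x (off2 (s k) i).
  by apply: laurent_relabelE => // l; rewrite -off2_relabel permK.
have neq k : k != t i -> s k != i.
  by apply: contra_neq => <-; rewrite permK.
split=> [k /neq ki||| k /neq ki].
- by rewrite yx' yx e1.
- by rewrite GF' GF permKV.
- by rewrite offE yx yx' GF permKV.
have [b [mu H]] := e4 _ ki; exists b, mu.
by rewrite /edge_independent /edge_dependent off2E !yx !yx' !GF !GF' !permKV.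
Qed.

End Relabel.

(** * Formal seeds *)

Section Formal.
Variables (S : idomainType) (n : nat) (K : fieldType) (scalar : {rmorphism S -> K}).
Implicit Types (p q : {mpoly S[n]}) (i j k : 'I_n) (x : 'I_n -> K).

Local Notation L x A := (laurent_in scalar x A).

Definition eval x : {rmorphism {mpoly S[n]} -> K} := mmap scalar x.

Definition alg_free x : Prop := forall p, eval x p = 0 -> p = 0.

Lemma evalX x k : eval x 'X_k = x k.
Proof. by rewrite -[LHS]/(mmap _ _ _) mmapX mmap1U. Qed.

Lemma evalC x c : eval x c%:MP = scalar c.
Proof. by rewrite -[LHS]/(mmap _ _ _) mmapC. Qed.

Lemma alg_free_neq0 x k : alg_free x -> x k != 0.
Proof.
move=> fx; apply: contraT => /negPn/eqP xk.
have /eqP := fx _ (etrans (evalX x k) xk).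
by rewrite -msupp_eq0 msuppX.
Qed.

Lemma laurent_eval x (A : pred 'I_n) p : (forall k, involves p k -> A k) -> L x A (eval x p).
Proof.
move=> pA; have sA := laurent_subring scalar x A.
rewrite /eval /= /mmap big_seq; apply: in_sum => // m mp; apply: inM => //.
  exact: Laurent_const.
apply: in_prod => // k _; case: (eqVneq (m k) 0%N) => [->|mk]; first exact: in1.
by apply: inX => //; apply/Laurent_var/pA/hasP; exists m.
Qed.

Lemma coefs_in_expand x j (A : pred 'I_n) p :
  (forall k, involves p k -> k != j -> A k) -> coefs_in (L x A) (expand scalar x j p).
Proof.
move=> pA; have sA := laurent_subring scalar x A.
rewrite /expand /= /mmap big_seq; apply: coefs_in_sum => // m mp; apply: coefs_inM => //.
  by apply: coefs_inC => //; apply: Laurent_const.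
apply: coefs_in_prod => // k _; case: (eqVneq (m k) 0%N) => [->|mk].
  exact: (@coefs_inXn _ _ sA 0).
apply: coefs_in_exp => //; case: eqP => [_|/eqP kj]; first exact: (@coefs_inXn _ _ sA 1).
by apply: coefs_inC => //; apply: Laurent_var; apply: pA => //; apply/hasP; exists m.
Qed.

Lemma expand_formal x j p : expand scalar x j p = map_poly (eval x) (formal j p).
Proof.
rewrite /formal rmorph_mmap; apply: eq_mmap => [c|k _] /=.
  by rewrite map_polyC /= /eval /= mmapC.
by case: eqP => _; rewrite ?map_polyX // map_polyC /= /eval /= mmapX mmap1U.
Qed.

(** ** Independence of the cluster *)

(** Fractions suffice: with polynomials on both sides the statement is stable
    under sums, products and inverses of variables. *)
Lemma laurent_formal x j a : (forall k, x k != 0) -> L x (off j) a ->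
  exists p q, [/\ eval x q != 0, formal j p = p%:P, formal j q = q%:P &
                  eval x q * a = eval x p].
Proof.
move=> x0; have fX k : off j k -> formal j 'X_k = ('X_k)%:P.
  by move=> kj; rewrite -[LHS]/(mmap _ _ _) mmapX mmap1U (negPf kj).
elim=> {a} [c|k kj|k kj|a b _ [p [q [q0 fp fq E]]] _ [p' [q' [q'0 fp' fq' E']]]
  |a b _ [p [q [q0 fp fq E]]] _ [p' [q' [q'0 fp' fq' E']]]].
- exists c%:MP, 1; rewrite !rmorph1 oner_neq0 mul1r; split=> //.
    by rewrite -[LHS]/(mmap _ _ _) mmapC.
  by rewrite evalC.
- by exists 'X_k, 1; rewrite !rmorph1 oner_neq0 mul1r evalX fX.
- by exists 1, 'X_k; rewrite !rmorph1 evalX fX // mulfV.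
- exists (p * q' + p' * q), (q * q'); rewrite !(rmorphM, rmorphD) /= mulf_neq0 //.
  split=> //; last by rewrite -E -E'; ring.
  + by rewrite fp fp' fq fq'.
  by rewrite fq fq'.
exists (p * p'), (q * q'); rewrite !rmorphM /= mulf_neq0 //; split.
- by [].
- by rewrite fp fp'.
- by rewrite fq fq'.
by rewrite -E -E'; ring.
Qed.

Lemma map_poly_MXaddC (U V : comNzRingType) (f : {rmorphism U -> V}) (c d : U) (P : {poly U}) :
  map_poly f (c *: P * 'X + d%:P) = f c *: map_poly f P * 'X + (f d)%:P.
Proof. by rewrite rmorphD rmorphM /= map_polyX map_polyC map_polyZ. Qed.

(** A relation with Laurent coefficients is turned into a polynomial one by a
    common denominator [q] free of [x j]. *)
Lemma cluster_independent x : alg_free x -> independent scalar x.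
Proof.
move=> fx j f Lf fx0.
have x0 k := alg_free_neq0 k fx.
have [P [q [q0 fq Pfree PE]]] : exists P q, [/\ eval x q != 0, formal j q = q%:P,
    map_poly (formal j) P = map_poly polyC P & map_poly (eval x) P = eval x q *: f].
  elim/poly_ind: f Lf {fx0} => [|f c IH] Lf.
    by exists 0, 1; rewrite !rmorph0 !rmorph1 oner_neq0 scaler0.
  have [|P [q [q0 fq fP PE]]] := IH.
    by move=> k; have := Lf k.+1; rewrite coefD coefMX coefC /= addr0.
  have [p' [q' [q'0 fp' fq' E']]] : exists p q, [/\ eval x q != 0, formal j p = p%:P,
      formal j q = q%:P & eval x q * c = eval x p].
    by apply: laurent_formal => //; have := Lf 0%N; rewrite coefD coefMX coefC /= add0r.
  exists (q' *: P * 'X + (q * p')%:P), (q * q'); split.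
  - by rewrite rmorphM mulf_neq0.
  - by rewrite rmorphM /= fq fq' polyCM.
  - have fqp : formal j (q * p') = (q * p')%:P by rewrite [LHS]rmorphM fq fp' polyCM.
    by rewrite !map_poly_MXaddC fP fq' fqp.
  by rewrite map_poly_MXaddC PE !rmorphM -E' -!mul_polyC !polyCM; ring.
have P0 : P = 0.
  have /fx : eval x P.['X_j] = 0.
    by rewrite -horner_map evalX /= PE hornerZ fx0 mulr0.
  move/(congr1 (formal j)); rewrite rmorph0 -horner_map /= formalX Pfree => E.
  by rewrite -[P]comp_polyXr.
have /eqP := PE; rewrite P0 rmorph0 eq_sym scaler_eq0 (negPf q0) /=.
by move/eqP.
Qed.

(** ** The two notions of Laurent polynomial *)

Lemma prodD x (m l : 'I_n -> nat) :
  \prod_k x k ^+ (m k + l k) = \prod_k x k ^+ m k * \prod_k x k ^+ l k.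
Proof. by rewrite -big_split; apply: eq_bigr => k _; rewrite exprD. Qed.

Lemma eval_monomial x (m : 'I_n -> nat) :
  eval x (\prod_k 'X_k ^+ m k) = \prod_k x k ^+ m k.
Proof. by rewrite rmorph_prod; apply: eq_bigr => k _; rewrite rmorphXn /= evalX. Qed.

Lemma laurentE x a : (forall k, x k != 0) ->
  (exists p (m : 'I_n -> nat), a = eval x p / \prod_k x k ^+ m k) <-> L x predT a.
Proof.
move=> x0; have sL := laurent_subring scalar x predT; split.
  move=> [p [m ->]]; apply: inM => //; first exact: laurent_eval.
  rewrite -prodfV; apply: in_prod => // k _; rewrite -exprVn.
  by apply: inX => //; apply: Laurent_inv.
have prod0 (m : 'I_n -> nat) : \prod_k x k ^+ m k != 0.
  by apply/prodf_neq0 => k _; rewrite expf_neq0.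
have prod1 : \prod_(k < n) x k ^+ 0 = 1 by apply: big1.
elim=> {a} [c|k _|k _|a b _ [p [m ->]] _ [q [l ->]]|a b _ [p [m ->]] _ [q [l ->]]].
- by exists c%:MP, (fun=> 0%N); rewrite prod1 divr1 evalC.
- by exists 'X_k, (fun=> 0%N); rewrite prod1 divr1 evalX.
- exists 1, (fun l => (l == k)%N : nat); rewrite rmorph1 div1r (bigD1 k) //= eqxx expr1.
  by rewrite big1 ?mulr1 // => l lk; rewrite (negPf lk).
- exists (p * (\prod_k 'X_k ^+ l k) + q * \prod_k 'X_k ^+ m k), (fun k => m k + l k)%N.
  rewrite prodD rmorphD !rmorphM /= !eval_monomial; have := prod0 m; have := prod0 l.
  move: (\prod_k x k ^+ m k) (\prod_k x k ^+ l k) => u v v0 u0; field.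
  by rewrite u0 v0.
exists (p * q), (fun k => m k + l k)%N.
by rewrite prodD rmorphM /= invfM; ring.
Qed.

(** ** Abstract seeds from formal ones *)

Lemma not_divides_monomial p (m : 'I_n -> nat) : prime_elt p ->
  (forall j, ~ divides 'X_j p) -> ~ divides p (\prod_k 'X_k ^+ m k).
Proof.
move=> [p0 pU pP] pX.
have n1 : ~ divides p 1.
  by move=> [c E]; case/negP: pU; apply/unitrP; exists c; rewrite mulrC -E.
elim/big_ind: _ => // [a b na nb /pP[]//|k _].
elim: (m k) => // l IH; rewrite exprS => /pP[] //.
exact: nondivisor_of_X.
Qed.

(** In the Laurent ring the monomials become units, and [p] is prime to them. *)
Lemma eval_prime x p : alg_free x -> prime_elt p ->
  (forall j, ~ divides 'X_j p) -> prime_in (L x predT) (eval x p).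
Proof.
move=> fx pp pX; have [p0 pU pP] := pp; have x0 k := alg_free_neq0 k fx.
have mon0 (m : 'I_n -> nat) : \prod_k x k ^+ m k != 0.
  by apply/prodf_neq0 => k _; rewrite expf_neq0.
have inj q r : eval x q = eval x r -> q = r.
  by move=> E; apply/eqP; rewrite -subr_eq0; apply/eqP/fx; rewrite rmorphB E subrr.
have descend q (m : 'I_n -> nat) :
    divides_in (L x predT) (eval x p) (eval x q / \prod_k x k ^+ m k) -> divides p q.
  move=> [c /(laurentE _ x0)[r [l ->]] E].
  have /inj E' : eval x (q * \prod_k 'X_k ^+ l k) = eval x (p * (r * \prod_k 'X_k ^+ m k)).
    rewrite !rmorphM /= !eval_monomial.
    apply: (mulIf (invr_neq0 (mon0 m))); rewrite mulrAC E; field.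
    by rewrite !mon0.
  have /pP[//|] : divides p (q * \prod_k 'X_k ^+ l k) by rewrite E'; eexists; reflexivity.
  by move/(not_divides_monomial pp pX).
split.
- exact: laurent_eval.
- by apply: contra_neq p0 => /fx.
- move=> H; have : divides p 1.
    by apply: (descend _ (fun=> 0%N)); rewrite rmorph1 div1r big1 ?invr1.
  by move=> [c E]; case/negP: pU; apply/unitrP; exists c; rewrite mulrC -E.
move=> a b /(laurentE _ x0)[q [m ->]] /(laurentE _ x0)[r [l ->]] H.
have /pP : divides p (q * r).
  by apply: (descend _ (fun k => m k + l k)%N); rewrite prodD rmorphM /= invfM mulrACA.
have ascend s (e : 'I_n -> nat) : divides p s ->
    divides_in (L x predT) (eval x p) (eval x s / \prod_k x k ^+ e k).
  move=> [c ->]; exists (eval x c / \prod_k x k ^+ e k); last by rewrite rmorphM mulrA.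
  by apply/(laurentE _ x0); exists c, e.
by case; [left|right]; apply: ascend.
Qed.

Lemma eval_prod_free x (A : pred 'I_n) (s : seq {mpoly S[n]}) : alg_free x ->
  (forall q, q \in s -> q != 0) -> (forall q k, q \in s -> involves q k -> A k) ->
  L x A (\prod_(q <- s) eval x q) /\ \prod_(q <- s) eval x q != 0.
Proof.
move=> fx s0 sA; have sL := laurent_subring scalar x A; split.
  by rewrite big_seq; apply: in_prod => // q qs; apply: laurent_eval => k; apply: sA.
rewrite big_seq; elim/big_ind: _ => [|a b a0 b0|q qs]; [exact: oner_neq0|exact: mulf_neq0|].
by apply: contra_neq (s0 q qs) => /fx.
Qed.

Lemma expand_neq0 x j p : alg_free x -> ~ divides 'X_j p -> (expand scalar x j p)`_0 != 0.
Proof.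
move=> fx pX; rewrite expand_formal coef_map; apply: contra_not_neq pX => /fx.
exact: divides_X.
Qed.

Lemma size_expand x j p : alg_free x -> involves p j -> (1 < size (expand scalar x j p))%N.
Proof.
move=> fx /size_formal; rewrite expand_formal size_map_inj_poly ?rmorph0 //.
by move=> q r E; apply/eqP; rewrite -subr_eq0; apply/eqP/fx; rewrite rmorphB E subrr.
Qed.

Lemma formal_abstract_seed x (P : 'I_n -> {mpoly S[n]}) :
  prime_factorial S -> alg_free x ->
  (forall i, irreducible_elt (P i)) -> (forall i j, ~ divides 'X_j (P i)) ->
  (forall i, ~~ involves (P i) i) ->
  abstract_seed scalar x (fun i => eval x (P i)).
Proof.
move=> fS fx irr nX own.
have off_i i k : involves (P i) k -> off i k.
  by apply: contraTneq => ->; apply: own.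
split=> [|i|i|i j ji].
- exact: cluster_independent.
- by apply: laurent_eval; exact: off_i.
- by apply: eval_prime => //; apply/prime_factorial_irreducible/irr/prime_factorial_mpoly.
exists (expand scalar x j (P i)); split.
- by apply: coefs_in_expand => k /off_i; rewrite /off /off2 => -> ->.
- by rewrite horner_expand_id.
exact: expand_neq0.
Qed.

End Formal.

(** * A mutation is an edge *)

Section MutationEdge.
Variables (S : idomainType) (n : nat) (K : fieldType) (scalar : {rmorphism S -> K}).
Implicit Types (p q : {mpoly S[n]}) (i k : 'I_n) (x y : 'I_n -> K).

Local Notation L x A := (laurent_in scalar x A).

Lemma unit_in_exprz (P : K -> Prop) u (m : int) :
  is_subring P -> unit_in P u -> unit_in P (u ^ m).
Proof.
move=> sP uU; case: m => m; first exact: unit_inX.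
by rewrite NegzE -exprnN; apply/unit_inV/unit_inX.
Qed.

Lemma unit_in_prod (P : K -> Prop) (C : pred 'I_n) (f : 'I_n -> K) : is_subring P ->
  (forall k, C k -> unit_in P (f k)) -> unit_in P (\prod_(k | C k) f k).
Proof.
move=> sP H; elim/big_ind: _ => //; last by move=> u v; apply: unit_inM.
by split; rewrite ?invr1 ?oner_neq0 //; exact: in1.
Qed.

Variables (x x' F' : 'I_n -> K) (P : 'I_n -> {mpoly S[n]}) (j : 'I_n) (a : 'I_n -> int).
Hypothesis fS : prime_factorial S.
Hypothesis x_free : alg_free scalar x.
Hypothesis P_irreducible : forall i, irreducible_elt (P i).
Hypothesis P_nX : forall i k, ~ divides 'X_k (P i).
Hypothesis P_own : forall i, ~~ involves (P i) i.
Hypothesis seed' : abstract_seed scalar x' F'.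

Let F i := eval scalar x (P i).

Definition hat y := (\prod_(k | k != j) y k ^ a k) * eval scalar y (P j).

Hypothesis a_le0 : forall k, k != j -> a k <= 0.
Hypothesis hat_laurent : forall i, i != j ->
  L x predT (hat [eta x with i |-> F i / x i]) /\
  ~ divides_in (L x predT) (F i) (hat [eta x with i |-> F i / x i]).
Hypothesis x'_j : x' j = hat x / x j.
Hypothesis x'_other : forall k, k != j -> x' k = x k.
Hypothesis F'_j : F' j = F j.
Hypothesis F'_independent : forall i, i != j -> ~~ involves (P i) j ->
  exists2 v : S, v \is a GRing.unit & F' i = scalar v * F i.
Hypothesis F'_dependent : forall i, i != j -> involves (P i) j ->
  exists d H (u : S) (m : 'I_n -> int),
    [/\ L x (off2 i j) d, d != 0,
        eval scalar [eta x' with j |-> hat [eta x with i |-> 0] / x' j] (P i) = d * H &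
        [/\ u \is a GRing.unit, m i = 0 &
            F' i = scalar u * (\prod_k x' k ^ m k) * H]].

Let ind : independent scalar x := cluster_independent x_free.
Let seed : abstract_seed scalar x F :=
  formal_abstract_seed fS x_free P_irreducible P_nX P_own.

Lemma unit_in_scalar A u : u \is a GRing.unit -> unit_in (L x A) (scalar u).
Proof.
move=> uU; split; first exact: Laurent_const.
  by rewrite -rmorphV //; exact: Laurent_const.
by rewrite -unitfE rmorph_unit.
Qed.

(** In a fixed direction [i], the exchange Laurent polynomial is
    [x i ^ (- b) * g (x i)], the coefficients of [g] being free of [x i] and
    [x j]. *)
Section Direction.
Variable i : 'I_n.
Hypothesis ij : i != j.

Let sR : is_subring (L x (off2 i j)). Proof. exact: laurent_subring. Qed.
Let sL : is_subring (L x predT). Proof. exact: laurent_subring. Qed.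

Let b := absz (a i).
Let mu := \prod_(k | (k != j) && (k != i)) x k ^ a k.
Let g := mu *: expand scalar x i (P j).

Lemma mu_unit : unit_in (L x (off2 i j)) mu.
Proof.
apply: unit_in_prod => // k /andP[kj ki]; apply: unit_in_exprz => //.
by apply: unit_in_var => //; rewrite /off2 ki.
Qed.

Lemma g_coefs : coefs_in (L x (off2 i j)) g.
Proof.
apply: coefs_inZ => //; first by case: mu_unit.
apply: coefs_in_expand => k kP ki; rewrite /off2 ki.
by apply: contraTneq kP => ->; apply: P_own.
Qed.

Lemma g_const : g`_0 != 0.
Proof. by rewrite coefZ mulf_neq0 ?expand_neq0 //; case: mu_unit. Qed.

Lemma hatE y : (forall k, k != i -> y k = x k) -> hat y = y i ^ a i * g.[y i].
Proof.
move=> yx; rewrite /hat (bigD1 i) //= -mulrA; congr (_ * _).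
rewrite hornerZ horner_expand; congr (_ * _).
  by apply: eq_bigr => k /andP[_ ki]; rewrite yx.
apply: eq_mmap => // k _ /=; case: eqP => [->//|/eqP]; exact: yx.
Qed.

Lemma a_i : a i = - b%:Z.
Proof. by have := a_le0 ij; rewrite /b; case: (a i) => // -[]. Qed.

Lemma hat_x : hat x * x i ^+ b = mu * F j.
Proof.
have xi0 := independent_neq0 i ind.
rewrite hatE // a_i -exprnN mulrAC mulVf ?mul1r ?expf_neq0 //.
by rewrite hornerZ horner_expand_id.
Qed.

Lemma hat_substituted :
  hat [eta x with i |-> F i / x i] = x i ^+ b / F i ^+ b * g.[F i / x i].
Proof.
rewrite hatE => [|k ki] /=; last by rewrite (negPf ki).
by rewrite eqxx a_i -exprnN expr_div_n invfM invrK [_^-1 * _]mulrC.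
Qed.

Lemma direction_independent : ~~ involves (P i) j ->
  edge_independent scalar x F j F' i b mu.
Proof.
move=> nij; have [lau ndiv] := hat_laurent ij; rewrite hat_substituted in lau ndiv.
have [_ F0 _ _] := seed_prime seed i; have xi0 := independent_neq0 i ind.
have RF : L x (off2 i j) (F i).
  apply: laurent_eval => k kP; apply/andP.
  by split; apply: contraTneq kP => ->.
have xE : F i / x i = 1 / x i * F i by rewrite mul1r mulrC.
have sV := laurent_subring scalar x (off i).
have one : unit_in (L x (off i)) 1 by split; rewrite ?invr1 ?oner_neq0 //; exact: in1.
have xiU : unit_in (L x predT) (x i) by apply: unit_in_var.
have [xL xL' _] := unit_inX sL b xiU.
split=> //.
  have [v vU ->] := F'_independent ij nij; exists (scalar v) => //.
  exact: unit_in_scalar.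
exists g; split.
- exact: g_coefs.
- by rewrite hornerZ horner_expand_id.
- apply: (laurent_rescaleV ind ij one g_coefs RF); rewrite ?expf_neq0 //; first exact: inX.
  rewrite -xE (_ : _ / _ = (x i ^+ b)^-1 * (x i ^+ b / F i ^+ b * g.[F i / x i])).
    exact: inM.
  by rewrite -mulrA mulKf ?expf_neq0 // mulrC.
move=> H; apply: ndiv; exists (x i ^+ b * (g.[1 / x i * F i] / F i ^+ b.+1)).
  apply: inM => //; apply: (laurent_rescale _ H).
  by rewrite div1r; apply: Laurent_inv.
by rewrite -xE exprS; field; rewrite F0 expf_neq0.
Qed.

Section Dependent.
Hypothesis iPj : involves (P i) j.

Let f := expand scalar x j (P i).

Lemma f_coefs : coefs_in (L x (off2 i j)) f.
Proof.
apply: coefs_in_expand => k kP kj; rewrite /off2 kj andbT.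
by apply: contraTneq kP => ->; apply: P_own.
Qed.

Lemma not_divides_constant d : L x (off2 i j) d -> d != 0 ->
  ~ divides_in (L x predT) (F i) d.
Proof.
move=> Rd d0; have -> : F i = f.[x j] by rewrite horner_expand_id.
apply: (not_divides_free ind _ f_coefs _ _ Rd d0); first exact: off2_sub.
  exact: expand_neq0.
exact: size_expand.
Qed.

(** With a denominator [x i ^ b], [b > 0], the substitution of [F i / x i] would
    be Laurent only if [F i] divided the constant term of [g]; but [F i] depends
    on [x j] and the constant term does not. *)
Lemma no_denominator : b = 0%N.
Proof.
apply/eqP; apply: contraT => b0; exfalso.
have [lau _] := hat_laurent ij; rewrite hat_substituted in lau.
have [FL F0 _ _] := seed_prime seed i.
have xi0 := independent_neq0 i ind.
have xiU : unit_in (L x predT) (x i) by apply: unit_in_var.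
have [xL xL' _] := xiU; have [_ xbL' _] := unit_inX sL b xiU.
have gL : coefs_in (L x predT) g by move=> k; apply: laurent_all; exact: g_coefs.
have yL : L x predT (F i / x i) by apply: inM.
have [c Lc gE] := horner_split sL gL yL.
apply: (not_divides_constant (g_coefs 0) g_const).
have -> : g`_0 = g.[F i / x i] - F i * ((x i)^-1 * (g`_1 + F i / x i * c)).
  by rewrite gE; ring.
apply: divides_inB => //; last first.
  eexists; last reflexivity.
  by apply: inM => //; apply: inD; [|exact: gL|exact: inM].
set h := x i ^+ b / F i ^+ b * g.[F i / x i] in lau.
exists (F i ^+ b.-1 * (h * (x i ^+ b)^-1)); first by apply: inM; [|exact: inX|exact: inM].
rewrite mulrA -exprS prednK ?lt0n // /h; field.
by rewrite !expf_neq0.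
Qed.

Lemma hat_at_zero : hat [eta x with i |-> 0] = g`_0.
Proof.
rewrite hatE => [|k ki] /=; last by rewrite (negPf ki).
by rewrite eqxx a_i no_denominator oppr0 expr0z mul1r horner_coef0.
Qed.

(** The definition of the mutated polynomial gives the relation between [f] and
    [f'] at [z = x' j] only; both sides being polynomials in [z] after
    multiplication by a power of [z], and [x' j] being transcendental, it holds
    identically. *)
Lemma direction_dependent : edge_dependent scalar x F j x' F' i mu.
Proof.
have [d [H [u [m [Rd d0 GE [uU mi F'E]]]]]] := F'_dependent ij iPj.
have ind' := seed_independent seed'; have x'j0 := independent_neq0 j ind'.
have ji : j != i by rewrite eq_sym.
have RE A e : subpred A (off j) -> L x A e <-> L x' A e.
  by move=> Aj; split; apply: laurent_eq => k Ak; split=> //; rewrite x'_other //; apply: Aj.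
have [f' [Lf' f'E f'0]] := seed_expand seed' ji.
have Rf' : coefs_in (L x (off2 i j)) f' by move=> k; apply/(RE _ _ (@off2_sub _ i j))/Lf'.
have {}GE : f.[g`_0 / x' j] = d * H.
  rewrite -GE hat_at_zero horner_expand; apply: eq_mmap => // k _ /=.
  by case: eqP => // /eqP kj; rewrite x'_other.
have Rg0 := g_coefs 0%N.
pose d' := scalar u * \prod_(k | k != j) x' k ^ m k.
have d'U : unit_in (L x (off2 i j)) d'.
  apply: unit_inM => //; first exact: unit_in_scalar.
  apply: unit_in_prod => // k kj; case: (eqVneq k i) => [->|ki].
    by rewrite mi expr0z; split; rewrite ?invr1 ?oner_neq0 //; exact: in1.
  apply: unit_in_exprz => //; rewrite x'_other //.
  by apply: unit_in_var => //; rewrite /off2 ki.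
have [Rd' _ d'0] := d'U.
have dE : d * F' i = d' * x' j ^ m j * f.[g`_0 / x' j].
  by rewrite GE F'E (bigD1 j) //= /d'; ring.
have [c [c' E]] : exists c c' : nat,
    d * x' j ^+ c' * f'.[x' j] = d' * x' j ^+ c * f.[g`_0 / x' j].
  case mE: (m j) => [c|c]; rewrite mE in dE.
    by exists c, 0%N; rewrite mulr1 -f'E dE.
  exists 0%N, c.+1; rewrite -f'E mulrAC dE mulr1 NegzE -exprnN.
  by rewrite mulrAC divfK // expf_neq0.
have f0 : f`_0 != 0 by apply: expand_neq0.
have sf : (1 < size f)%N by apply: size_expand.
pose N := size f; pose r := reversal g`_0 f.
have rE z : z != 0 -> r.[z] = f.[g`_0 / z] * z ^+ N by apply: horner_reversal.
have idE : d *: 'X^(c' + N) * f' = d' *: 'X^c * r.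
  apply/eqP; rewrite -subr_eq0; apply/eqP/(ind' j).
    have sub : subpred (off2 i j) (off j) by exact: off2_sub.
    have Rr : coefs_in (L x (off2 i j)) r by apply: coefs_in_reversal => //; exact: f_coefs.
    move=> k; apply/(RE _ _ (fun k kj => kj))/(laurent_sub sub); move: k.
    apply: coefs_inB => //; apply: coefs_inM => //; apply: coefs_inZ => //.
      exact: coefs_inXn.
    exact: coefs_inXn.
  apply/eqP; rewrite hornerD hornerN !hornerM !hornerZ !hornerXn rE // subr_eq0; apply/eqP.
  transitivity (d * x' j ^+ c' * f'.[x' j] * x' j ^+ N).
    by rewrite (exprD _ c' N) mulrA mulrAC.
  by rewrite E mulrA.
exists f, f', g; split.
- by split=> //; [exact: f_coefs|rewrite horner_expand_id].
- split=> //; rewrite ltnNge; apply/negP => /size1_polyC f'C.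
  (* A constant f' would make the reversal of f a monomial, but it has nonzero
     coefficients in the degrees N and 1, from the two ends of f. *)
  have coefE (k : nat) : (d *: 'X^(c' + N) * f')`_k = (d' *: 'X^c * r)`_k by rewrite idE.
  have rcoef (k : nat) : (k < N)%N ->
      (d' *: 'X^c * r)`_(c + (N - k)) = d' * (f`_k * g`_0 ^+ k).
    move=> kN; rewrite -scalerAl coefZ coefXnM ltnNge leq_addr addKn.
    by rewrite coef_reversal.
  have mono (k : nat) : (d *: 'X^(c' + N) * f')`_k != 0 -> k = (c' + N)%N.
    rewrite f'C coefMC coefZ coefXn; case: (k =P _) => // _.
    by rewrite mulr0 mul0r eqxx.
  have N1 : (1 < N)%N by [].
  have /mono e0 : (d *: 'X^(c' + N) * f')`_(c + (N - 0)) != 0.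
    by rewrite coefE rcoef ?(ltnW N1) //; do 2!apply: mulf_neq0 => //; apply/expf_neq0/g_const.
  have /mono e1 : (d *: 'X^(c' + N) * f')`_(c + (N - N.-1)) != 0.
    rewrite coefE rcoef ?prednK ?(ltnW N1) //; do 2!apply: mulf_neq0 => //.
      by rewrite -[f`__]/(lead_coef f) lead_coef_eq0 -size_poly_gt0 ltnW.
    exact/expf_neq0/g_const.
  have : (N - 0 = N - N.-1)%N by apply/(@addnI c); rewrite e0 e1.
  by rewrite subn0; case: (N) N1 => [|[|l]] //= _; rewrite subSnn.
- by split; [exact: g_coefs|rewrite hornerZ horner_expand_id|exact: g_const].
exists d', d, c, c'; split=> // z z0.
have zN := expf_neq0 N z0; apply: (mulIf zN).
have := congr1 (horner^~ z) idE; rewrite /= !hornerM !hornerZ !hornerXn rE //.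
rewrite (exprD _ c' N) => Ez.
transitivity (d * (z ^+ c' * z ^+ N) * f'.[z]); first by rewrite [in RHS]mulrA mulrAC.
by rewrite Ez mulrA.
Qed.

End Dependent.
End Direction.

Theorem mutation_edge : edge scalar x F j x' F'.
Proof.
have xj0 := independent_neq0 j ind.
have xx' : x j * x' j = hat x by rewrite x'_j mulrC divfK.
split=> // [|i ij].
  exists (\prod_(k | k != j) x k ^ a k); last by rewrite xx'.
  apply: unit_in_prod => // k kj; apply: unit_in_exprz => //.
  exact: unit_in_var.
exists (absz (a i)), (\prod_(k | (k != j) && (k != i)) x k ^ a k).
split; first exact: mu_unit; first by rewrite xx'; apply: hat_x.
case: (boolP (involves (P i) j)) => [iPj|nij]; [right|left].
  by split; [exact: no_denominator|exact: direction_dependent].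
exact: direction_independent.
Qed.

End MutationEdge.

(** * Laurent phenomenon algebras *)

Section Algebra.
Variables (S : idomainType) (n : nat).
Implicit Types (t u v : seed_data S n) (i j k : 'I_n).

Definition scalar : {rmorphism S -> ambient S n} :=
  @tofrac {mpoly {fraction S}[n]} \o @mpolyC n {fraction S} \o @tofrac S.

Implicit Types (x F : 'I_n -> ambient S n).

Lemma basis_free x : transcendence_basis x -> alg_free scalar x.
Proof.
move=> [free _] p p0.
pose f : {rmorphism {fraction S} -> ambient S n} :=
  @tofrac {mpoly {fraction S}[n]} \o @mpolyC n {fraction S}.
pose m : {rmorphism {mpoly {fraction S}[n]} -> ambient S n} := mmap f x.
have pE : m (map_mpoly (@tofrac S) p) = eval scalar x p.
  rewrite rmorph_mmap; apply: eq_mmap => [c|k _].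
    exact: (mmapC x f).
  by rewrite /= -[LHS]/(mmap f x _) mmapX mmap1U.
have /free/mpolyP E : m (map_mpoly (@tofrac S) p) = 0 by rewrite pE.
apply/mpolyP => e; have := E e; rewrite mcoeff_map_mpoly !mcoeff0 => /eqP.
by rewrite tofrac_eq0 => /eqP.
Qed.

Lemma laurent_in_laurent x a : transcendence_basis x ->
  laurent x a <-> laurent_in scalar x predT a.
Proof.
move=> /basis_free fx; have H := @laurentE _ _ _ scalar x a (fun k => alg_free_neq0 k fx).
exact: H.
Qed.

Hypothesis fS : prime_factorial S.

Lemma is_seed_abstract t : is_seed t -> abstract_seed scalar (cluster t) (exch_val t).
Proof.
move=> [tb irr nX own].
exact: (formal_abstract_seed fS (basis_free tb) irr (fun i j => nX i j) own).
Qed.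

Lemma laurent_divides_in x a b : transcendence_basis x ->
  laurent_divides x a b <-> divides_in (laurent_in scalar x predT) a b.
Proof. by move=> tb; split=> -[c /(laurent_in_laurent _ tb) ? ->]; exists c. Qed.

Lemma is_mutation_edge t j t' : is_seed t ->
  abstract_seed scalar (cluster t') (exch_val t') -> mutation t j t' ->
  edge scalar (cluster t) (exch_val t) j (cluster t') (exch_val t').
Proof.
move=> ts s' [a [a_le0 ha] [x'j x'k F'j F'k]].
have [tb irr nX own] := ts; have fx := basis_free tb.
apply: (mutation_edge fS fx irr nX own s' a_le0 _ x'j x'k F'j).
- move=> i ij; have [lau ndiv] := ha i ij; split.
    exact/(laurent_in_laurent _ tb).
  by move/(laurent_divides_in _ _ tb).
- move=> i ij nij; have := F'k i ij; rewrite (negPf nij) => -[v vU E].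
  by exists v.
move=> i ij iij; have := F'k i ij; rewrite iij.
move=> [H [[LH [s sP GE] _] [u [m [uU mi E _ _]]]]].
have s0 q : q \in s -> q != 0 by move=> /sP[[]].
have s_off q k : q \in s -> involves q k -> off2 i j k.
  move=> /sP[_ /andP[qj qi] _ _] kq; apply/andP.
  by split; apply: contraTneq kq => ->.
have [prodL prod0] := eval_prod_free fx s0 s_off.
exists (\prod_(q <- s) eval scalar (cluster t) q), H, u, m.
by split.
Qed.

Variable A : LPalgebra S n.

(** Seeds are taken with all their numberings, so that a mutation can always
    keep the numbering of the seed it starts from. *)
Definition numbered_seed x F : Prop := exists t (s : 'S_n),
  [/\ lp_seed A t, forall k, x k = cluster t (s k) & forall k, F k = exch_val t (s k)].

Lemma numbered_seed_abstract x F : numbered_seed x F -> abstract_seed scalar x F.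
Proof.
move=> [t [s [At xE FE]]]; apply: (seed_relabel xE FE).
exact/is_seed_abstract/(lp_seedP At).
Qed.

(** The seed reached by a mutation, with the numbering inherited from [t]. *)
Lemma lp_mut_edge t i : lp_seed A t -> exists x' F' (s : 'S_n),
  [/\ forall k, x' k = cluster (lp_mut A t i) (s k),
      forall k, F' k = exch_val (lp_mut A t i) (s k) &
      edge scalar (cluster t) (exch_val t) i x' F'].
Proof.
move=> At; have [t' mt' [s sE]] := lp_mutP i At.
have xE k : cluster t' k = cluster (lp_mut A t i) ((s^-1)%g k).
  by have [-> _] := sE ((s^-1)%g k); rewrite permKV.
have FE k : exch_val t' k = exch_val (lp_mut A t i) ((s^-1)%g k).
  by have [_ ->] := sE ((s^-1)%g k); rewrite permKV.
exists (cluster t'), (exch_val t'), (s^-1)%g; split=> //.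
apply: is_mutation_edge mt'; first exact: lp_seedP At.
apply: numbered_seed_abstract; exists (lp_mut A t i), (s^-1)%g.
by split=> //; exact: lp_mut_seed.
Qed.

Lemma numbered_seed_mutation x F i : numbered_seed x F ->
  exists x' F', numbered_seed x' F' /\ edge scalar x F i x' F'.
Proof.
move=> [t [s [At xE FE]]].
have [x' [F' [r [x'E F'E e]]]] := lp_mut_edge (s i) At.
exists (x' \o s), (F' \o s); split.
  exists (lp_mut A t (s i)), (s * r)%g; split=> [|k|k]; first exact: lp_mut_seed.
    by rewrite /= x'E permM.
  by rewrite /= F'E permM.
by rewrite -{1}(permK s i); apply: (edge_relabel xE FE _ _ e).
Qed.

(** Steps taken against the direction of a mutation are reversed by [edge_sym]. *)
Lemma connected_reach t t' : lp_seed A t -> lp_seed A t' ->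
  forall x F (s : 'S_n), (forall k, x k = cluster t (s k)) ->
    (forall k, F k = exch_val t (s k)) ->
  exists m y (s' : 'S_n), reach scalar numbered_seed m x F y /\
    forall k, y k = cluster t' (s' k).
Proof.
move=> At At' ; have := lp_connected At At'; move/clos_rst_rst1n_iff=> c.
elim: c At {At'} => {t t'} [t|t u t' step _ IH] At x F s xE FE.
  by exists 0%N, x, s; split=> //; split=> //; exists t, s.
have nt : numbered_seed x F by exists t, s.
have Au : lp_seed A u.
  by case: step => -[Av [i E]] //; rewrite E; exact: lp_mut_seed.
suff [i [x' [F' [r [e x'E F'E]]]]] : exists i x' F' (r : 'S_n),
    [/\ edge scalar x F i x' F', forall k, x' k = cluster u (r k) &
        forall k, F' k = exch_val u (r k)].
  have [m [y [s' [ry yE]]]] := IH Au x' F' r x'E F'E.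
  by exists m.+1, y, s'; split=> //; split=> //; exists i, x', F'.
case: step => -[Av [i E]].
  have [x' [F' [r [x'E F'E e]]]] := lp_mut_edge i At.
  exists ((s^-1)%g i), (x' \o s), (F' \o s), (s * r)%g; split=> [|k|k].
  - exact: (edge_relabel xE FE _ _ e).
  - by rewrite /= x'E permM E.
  by rewrite /= F'E permM E.
have [x' [F' [r [x'E F'E e]]]] := lp_mut_edge i Au; rewrite -E in x'E F'E.
pose q := (s * r^-1)%g.
exists ((q^-1)%g i), (cluster u \o q), (exch_val u \o q), q; split=> //.
by apply: (edge_relabel _ _ _ _ (edge_sym e)) => k //=;
   rewrite ?xE ?FE ?x'E ?F'E permM permKV.
Qed.

End Algebra.

Theorem theorem5p1 (S : idomainType) (hS : UFD S) (n : nat) (hn : (1 <= n)%N)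
    (A : LPalgebra S n) (t : seed_data S n) (ht : lp_seed A t)
    (t' : seed_data S n) (ht' : lp_seed A t') (i : 'I_n) :
  laurent (cluster t) (cluster t' i).
Proof.
have fS := UFD_prime_factorial hS.
have [tb _ _ _] := lp_seedP ht; apply/(laurent_in_laurent _ tb).
have id1 (f : 'I_n -> ambient S n) k : f k = f ((1%g : 'S_n) k) by rewrite perm1.
have [m [y [s [r yE]]]] := connected_reach fS ht ht' (id1 _) (id1 _).
have -> : cluster t' i = y ((s^-1)%g i) by rewrite yE permKV.
apply: reach_laurent r; first exact: numbered_seed_abstract.
by move=> x F j; apply: numbered_seed_mutation.
Qed.
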